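(* Let $G=(V,E)$ be a graph of treewidth at most $r-1$. For any terminal set $T \subseteq V$ with $\kappa'_G(T) \ge k$, there exist $\Omega\!\left(k/(12 r^2 \log(3r))\right)$ element-disjoint Steiner trees on $T$.
   Context: Vertices not in $T$ are non-terminals. For terminals $u,v$, $\kappa'_G(u,v)$ is the maximum number of $u$-$v$ paths pairwise disjoint in edges and non-terminal vertices (they may share terminals), and $\kappa'_G(T)=\min_{u,v\in T}\kappa'_G(u,v)$. A Steiner tree on $T$ is a subtree of $G$ containing all of $T$; Steiner trees are element-disjoint if they share no edges and no non-terminal vertices. *)

(* Defs.v *)
From mathcomp Require Import all_boot.
From mathcomp Require Import boolp.

Set Implicit Arguments.
Unset Strict Implicit.
Unset Printing Implicit Defensive.

Record sgraph := SGraph {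
  svertex :> finType;
  sedge : rel svertex;
  sedge_sym : symmetric sedge;
  sedge_irr : irreflexive sedge }.

Definition edges (G : sgraph) : {set {set G}} :=
  [set [set p.1; p.2] | p : G * G & sedge p.1 p.2].

(* [A] is the vertex set and [e] the (symmetric, irreflexive) adjacency relation
   of the candidate tree; [e] is expected to relate elements of [A] only. *)
Definition is_tree (I : finType) (A : {set I}) (e : rel I) : Prop :=
  [/\ A != set0,
      {in A &, forall x y, connect e x y}
    & forall c : seq I, 2 < size c -> ~ ucycle e c].

Definition tree_decomposition (G D : sgraph) (B : D -> {set G}) : Prop :=
  [/\ is_tree [set: D] (@sedge D),
      forall v : G, exists i, v \in B i,
      forall x y : G, sedge x y -> exists i, (x \in B i) && (y \in B i)
    & forall (v : G) (i j : D), v \in B i -> v \in B j ->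
        connect [rel a b | [&& sedge a b, v \in B a & v \in B b]] i j].

(* Differs from the usual value only on the empty graph (0 instead of -1). *)
Definition width (G D : sgraph) (B : D -> {set G}) : nat :=
  (\max_(i : D) #|B i|).-1.

Definition has_decomposition_of_width (G : sgraph) (w : nat) : bool :=
  `[< exists (D : sgraph) (B : D -> {set G}),
        tree_decomposition B /\ width B = w >].

Lemma ex_decomposition (G : sgraph) : exists w, has_decomposition_of_width G w.
Proof.
have s0 : symmetric (fun _ _ : unit => false) by [].
have i0 : irreflexive (fun _ : unit => fun _ => false) by [].
pose D := SGraph s0 i0; pose B (_ : D) := [set: G].
exists (width B); apply/asboolP; exists D, B; split=> //; split.
- split; first by apply/set0Pn; exists tt.
  + by move=> [] [] _ _; exact: connect0.
  + by move=> [|[] [|[] c]] // _; rewrite /ucycle /ucycleb /=.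
- by move=> v; exists tt; rewrite inE.
- by move=> x y _; exists tt; rewrite !inE.
- by move=> v [] [] _ _; exact: connect0.
Qed.

Definition treewidth (G : sgraph) : nat := ex_minn (ex_decomposition G).

Definition is_path (G : sgraph) (u v : G) (p : seq G) : bool :=
  [&& path (@sedge G) u p, last u p == v & uniq (u :: p)].

Definition path_edges (G : sgraph) (u : G) (p : seq G) : seq {set G} :=
  pairmap (fun x y => [set x; y]) u p.

Definition disjoint_paths (G : sgraph) (T : {set G}) (u v : G) (m : nat) : Prop :=
  exists p : 'I_m -> seq G,
    (forall i, is_path u v (p i)) /\
    (forall i j, i != j ->
       (forall f, f \in path_edges u (p i) -> f \notin path_edges u (p j)) /\
       (forall x, x \notin T -> x \in u :: p i -> x \notin u :: p j)).

(* Edge-disjoint paths between distinct vertices [u], [v] use distinct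
   neighbours of [u], so there are fewer than [#|G|] of them. *)
Lemma disjoint_paths_lt (G : sgraph) (T : {set G}) (u v : G) (m : nat) :
  u != v -> disjoint_paths T u v m -> m < #|G|.
Proof.
move=> uv [p [Pp Dp]].
have E i : exists2 x, x != u & p i = x :: behead (p i).
  move: (Pp i); case: (p i) => [|x q]; rewrite /is_path /=.
    by rewrite (negPf uv).
  case/and3P=> _ _; rewrite inE negb_or => /andP[/andP[ux _] _].
  by exists x => //; rewrite eq_sym.
pose h i := head u (p i).
have hinj : injective h.
  move=> i j hij; apply/eqP; apply: contraT => /Dp [De _].
  have [x _ Ei] := E i; have [y _ Ej] := E j.
  move: hij; rewrite /h Ei Ej /= => xy; subst y.
  have := De [set u; x]; rewrite Ei Ej /path_edges /= !inE eqxx /=.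
  by move=> /(_ isT).
have := card_codom hinj; rewrite card_ord => <-.
rewrite -cardsT; apply: proper_card; apply/properP.
split; first by apply/subsetP => x _; rewrite inE.
exists u; first by rewrite inE.
apply/negP => /codomP [i]; rewrite /h; have [x xu ->] := E i.
by move=> /= ux; rewrite ux eqxx in xu.
Qed.

Definition element_connectivity (G : sgraph) (T : {set G}) (u v : G) : nat :=
  \max_(m < #|G| | `[< disjoint_paths T u v m >]) m.

Lemma element_connectivity_geP (G : sgraph) (T : {set G}) (u v : G) (k : nat) :
  u != v -> k <= element_connectivity T u v <-> disjoint_paths T u v k.
Proof.
move=> uv; split=> [|kP]; last first.
  have lt := disjoint_paths_lt uv kP.
  by apply: (@leq_bigmax_cond _ _ _ (Ordinal lt)); apply/asboolP.
have sub m : disjoint_paths T u v m -> k <= m -> disjoint_paths T u v k.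
  move=> [p [Pp Dp]] km; exists (fun i => p (widen_ord km i)); split=> // i j ij.
  by apply: Dp; apply: contra ij => /eqP/(congr1 val)/= /val_inj ->.
have P0 : disjoint_paths T u v 0 by exists (fun=> [::]); split=> -[].
have G0 : 0 < #|G| by apply/card_gt0P; exists u.
rewrite /element_connectivity (@bigmax_eq_arg _ (Ordinal G0)); last exact/asboolP.
by case: arg_maxnP => [|m /asboolP Pm _]; [exact/asboolP | exact: sub].
Qed.

(* The minimum ranges over pairs of distinct terminals; [#|G|] is a neutral
   default, since [element_connectivity T u v < #|G|] for [u != v]. *)
Definition set_element_connectivity (G : sgraph) (T : {set G}) : nat :=
  \big[minn/#|G|]_(p : G * G | [&& p.1 \in T, p.2 \in T & p.1 != p.2])
     element_connectivity T p.1 p.2.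

Lemma set_element_connectivity_geP (G : sgraph) (T : {set G}) (k : nat) :
  1 < #|T| ->
  k <= set_element_connectivity T <->
  {in T &, forall u v, u != v -> k <= element_connectivity T u v}.
Proof.
move=> T2; split=> [kT u v uT vT uv|H].
  apply: leq_trans kT _; rewrite /set_element_connectivity.
  have : (u, v) \in index_enum (G * G)%type by rewrite mem_index_enum.
  elim: (index_enum _) => // a s IH; rewrite inE big_cons => /orP[/eqP <-|/IH le].
    by rewrite /= uT vT uv geq_minl.
  by case: ifP => // _; exact: leq_trans (geq_minr _ _) le.
rewrite /set_element_connectivity; elim/big_ind: _ => [|x y|[u v] /= /and3P[]].
- have [u [v [uT vT uv]]] := card_gt1P T2.
  apply: ltnW; apply: (disjoint_paths_lt uv).
  exact/(element_connectivity_geP T k uv)/H.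
- by rewrite leq_min => -> ->.
- exact: H.
Qed.

Record subgraph (G : sgraph) := Subgraph {
  sub_vertices : {set G};
  sub_edges : {set {set G}};
  sub_edgesP : sub_edges \subset edges G;
  sub_endsP : forall f, f \in sub_edges -> f \subset sub_vertices }.

Definition steiner_tree (G : sgraph) (T : {set G}) (S : subgraph G) : Prop :=
  is_tree (sub_vertices S) [rel x y | [set x; y] \in sub_edges S] /\
  T \subset sub_vertices S.

Definition element_disjoint (G : sgraph) (T : {set G}) (S1 S2 : subgraph G) : Prop :=
  [disjoint sub_edges S1 & sub_edges S2] /\
  sub_vertices S1 :&: sub_vertices S2 \subset T.

(* Main.v *)
Require Import Defs.
From mathcomp Require Import all_boot all_order all_algebra.
From mathcomp Require Import boolp reals exp.
From mathcomp Require Import zify.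

(** Only cuts of the element-connectivity are needed.  An edge [pq] between two
non-terminals can be deleted or contracted without destroying the cut condition:
otherwise two tight cuts, one separating [p] from [q] and one having both among
its removed vertices, uncross to a cut that is too small.  Repeating this turns
[G] into a hypergraph on the terminals whose hyperedges are disjoint connected
sets of non-terminals (and edges between terminals), in which every cut is
crossed by at least [k] hyperedges.

Suppose the terminals are partitioned into parts, each of them connected by the
hyperedges inside it.  The parts with these hyperedges are connected in [G], and
a lowest one in the tree decomposition has all but [r] of its at least [k]
outgoing hyperedges inside the at most [r] parts that meet a single bag.  Among
these parts some subfamily has all its cuts of size at least [m r], so greedily
[m] disjoint connected families of at most [r] hyperedges each can be chosen in
it.  The subfamily is merged into one part, one family for each of the [m]
colours; at the end each colour connects all terminals.  This works for
[m r^2 + r <= k], and one tree always exists when [k > 0]. *)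

Set Implicit Arguments.
Unset Strict Implicit.
Unset Printing Implicit Defensive.

(** * Dense hypergraphs *)

Section Hypergraph.
Variables (Q I : finType) (q : I -> {set Q}).
Implicit Types (A S : {set Q}) (F H : {set I}).

Definition crosses A i := (q i :&: A != set0) && (q i :\: A != set0).

(** Connectivity is expressed through cuts, so that no walks in hypergraphs are needed;
    [connected_in] does the same for graphs. *)
Definition hconnected F S :=
  forall A, S :&: A != set0 -> S :\: A != set0 ->
  exists i, [&& i \in F, q i \subset S & crosses A i].

Definition hcut H S A := [set i in H | (q i \subset S) && crosses A i].

Lemma hconnected_mono F F' S :
  (forall i, i \in F -> q i \subset S -> i \in F') ->
  hconnected F S -> hconnected F' S.
Proof.
move=> FF' cF A SA SnA; have [i /and3P[iF iS iA]] := cF A SA SnA.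
by exists i; rewrite (FF' i) ?iS.
Qed.

(** Take [S'] inclusion-minimal among the sets with at least two vertices that span at least
    [mu * (#|S'| - 1)] hyperedges. By minimality, the two sides of a cut of [S'] span together at
    most [mu * (#|S'| - 2)] of them, so at least [mu] hyperedges cross. *)
Lemma dense_subset H S mu :
  (forall i, i \in H -> 1 < #|q i| /\ q i \subset S) -> H != set0 ->
  mu * #|S|.-1 <= #|H| ->
  exists2 S' : {set Q}, S' \subset S & 1 < #|S'| /\
    forall A, S' :&: A != set0 -> S' :\: A != set0 -> mu <= #|hcut H S' A|.
Proof.
move=> Hq /set0Pn[i0 i0H] HS.
pose h S0 := #|[set i in H | q i \subset S0]|.
pose P S0 := (1 < #|S0|) && (mu * #|S0|.-1 <= h S0).
have PS : P S.
  have [lt1 sub] := Hq _ i0H.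
  rewrite /P (leq_trans lt1 (subset_leq_card sub)) (leq_trans HS) //.
  by apply: subset_leq_card; apply/subsetP=> i iH; rewrite inE iH; case: (Hq i iH).
have [S' /minsetP[/andP[S'1 S'h] minS'] S'S] := minset_exists PS.
exists S' => //; split=> // A SA SnA.
(* For a singleton both sides are 0, because each hyperedge has at least two vertices. *)
have small S0 : S0 != set0 -> S0 \proper S' -> h S0 <= mu * #|S0|.-1.
  rewrite -card_gt0 => S0n S0S'.
  have [S01|S01] := leqP #|S0| 1.
    rewrite /h; suff -> : [set i in H | q i \subset S0] = set0 by rewrite cards0.
    apply/setP=> i; rewrite !inE; apply/negP=> /andP[iH iS0].
    by have [] := Hq i iH; rewrite ltnNge (leq_trans (subset_leq_card iS0)).
  apply: ltnW; rewrite ltnNge; apply/negP=> hS0.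
  have := minS' S0; rewrite /P S01 hS0 => /(_ isT (proper_sub S0S')) E.
  by rewrite E properxx in S0S'.
have p1 : S' :&: A \proper S'.
  rewrite properE subsetIl /=; apply: contra SnA => /subsetP sub.
  by rewrite setD_eq0; apply/subsetP=> x /sub; rewrite inE => /andP[].
have p2 : S' :\: A \proper S'.
  rewrite properE subsetDl /=; apply: contra SA => /subsetP sub.
  rewrite setI_eq0 disjoint_sym; apply/pred0P=> x /=; apply/negP=> /andP[xA /sub].
  by rewrite inE xA.
have h1 := small _ SA p1; have h2 := small _ SnA p2.
have hS : h S' <= h (S' :&: A) + h (S' :\: A) + #|hcut H S' A|.
  apply: (@leq_trans #|([set i in H | q i \subset S' :&: A] :|:
     [set i in H | q i \subset S' :\: A]) :|: hcut H S' A|); last first.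
    by apply: leq_trans (leq_card_setU _ _) _; rewrite leq_add2r leq_card_setU.
  apply: subset_leq_card; apply/subsetP=> i; rewrite !inE => /andP[iH iS'].
  rewrite iH iS' /= /crosses subsetI iS' subsetD iS' /=.
  by rewrite -setI_eq0 setD_eq0; case: (q i \subset A); case: (q i :&: A == set0).
have cS := cardsID A S'.
have c1 : 0 < #|S' :&: A| by rewrite card_gt0.
have c2 : 0 < #|S' :\: A| by rewrite card_gt0.
case: #|S' :&: A| cS c1 h1 => // a cS _ h1.
case: #|S' :\: A| cS c2 h2 => // b cS _ h2.
move: S'h; rewrite -cS /= => S'h; move: h1 h2 => /= h1 h2.
have -> : mu = mu * (a.+1 + b.+1).-1 - (mu * a + mu * b).
  by rewrite -mulnDr addSn addnS /= mulnS addnK.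
by rewrite leq_subLR; apply: leq_trans S'h (leq_trans hS _); lia.
Qed.

(** Grow a connected set [R] from a single vertex. While [R] differs from [S], a hyperedge of the
    cut at [R] joins at least one new vertex to it, so the number of chosen hyperedges never exceeds
    [#|R|]. *)
Lemma small_connected_subset H S :
  S != set0 ->
  (forall A, S :&: A != set0 -> S :\: A != set0 -> hcut H S A != set0) ->
  exists2 F : {set I}, F \subset H & hconnected F S /\ #|F| <= #|S|.
Proof.
move=> Sn cutS.
suff grow n (R : {set Q}) F : #|S :\: R| <= n -> R \subset S -> R != set0 ->
    F \subset H -> hconnected F R -> #|F| <= #|R| ->
    exists2 F : {set I}, F \subset H & hconnected F S /\ #|F| <= #|S|.
  have /set0Pn[s sS] := Sn.
  apply: (grow _ [set s] set0 (leqnn _)); rewrite ?sub1set ?sub0set ?cards0 //.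
    by apply/set0Pn; exists s; rewrite inE.
  move=> A /set0Pn[x]; rewrite !inE => /andP[/eqP -> sA].
  by move=> /set0Pn[y]; rewrite !inE => /andP[yA /eqP yE]; rewrite yE sA in yA.
elim: n R F => [|n IH] R F.
  rewrite leqn0 cards_eq0 setD_eq0 => SR RS _ FH cF Fc.
  have <- : R = S by apply/eqP; rewrite eqEsubset RS SR.
  by exists F.
move=> cardR RS Rn FH cF Fc.
have [SR|SR] := boolP (S \subset R).
  have <- : R = S by apply/eqP; rewrite eqEsubset RS SR.
  by exists F.
have /set0Pn[i] : hcut H S R != set0.
  by apply: cutS; rewrite ?setD_eq0 // (setIidPr RS).
rewrite inE => /and3P[iH iS /andP[/set0Pn[x]]].
rewrite inE => /andP[xi xR] /set0Pn[y]; rewrite inE => /andP[yR yi].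
apply: (IH (R :|: q i) (i |: F)).
- rewrite -ltnS; apply: leq_trans cardR; apply: proper_card.
  apply/properP; split; first by apply: setDS; apply: subsetUl.
  exists y; first by rewrite inE yR (subsetP iS).
  by rewrite !inE yi orbT.
- by rewrite subUset RS.
- by apply/set0Pn; exists x; rewrite inE xR.
- by rewrite subUset sub1set iH.
- move=> A A1 A2.
  have [/andP[RA RnA]|nR] := boolP ((R :&: A != set0) && (R :\: A != set0)).
    have [j /and3P[jF jR jA]] := cF A RA RnA.
    by exists j; rewrite jA inE jF orbT (subset_trans jR (subsetUl _ _)).
  (* [R] and [q i] share the vertex [x]: if [A] splits neither of them, then it does not split their
     union. *)
  exists i; rewrite !inE eqxx subsetUr /=; apply/negPn/negP=> niA.
  have xx z : z \in R :|: q i -> (z \in A) = (x \in A).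
    move: niA nR; rewrite /crosses !negb_and !negbK.
    move=> Hq HR; rewrite inE => /orP[zR|zi].
      case/orP: HR => /eqP/setP HR.
        by have := HR z; have := HR x; rewrite !inE zR xR /= => -> ->.
      by have := HR z; have := HR x; rewrite !inE zR xR /= !andbT
         => /negbFE -> /negbFE ->.
    case/orP: Hq => /eqP/setP Hq.
      by have := Hq z; have := Hq x; rewrite !inE zi xi /= => -> ->.
    by have := Hq z; have := Hq x; rewrite !inE zi xi /= !andbT
         => /negbFE -> /negbFE ->.
  case/set0Pn: A1 => a /setIP[aU aA]; case/set0Pn: A2 => b /setDP[bU bA].
  by rewrite (xx b bU) -(xx a aU) aA in bA.
- apply: leq_trans (leq_card_setU _ _) _; rewrite cards1.
  apply: leq_ltn_trans Fc _; apply: proper_card; apply/properP.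
  by split; [exact: subsetUl | exists y; rewrite // inE yi orbT].
Qed.

(* Greedy extraction: a connecting family of at most [#|S|] hyperedges lowers
   every cut by at most [#|S|]. *)
Lemma connected_colouring m H S :
  S != set0 ->
  (forall A, S :&: A != set0 -> S :\: A != set0 -> m * #|S| <= #|hcut H S A|) ->
  exists col : I -> nat,
    forall c, c < m -> hconnected [set i in H | col i == c] S.
Proof.
move=> Sn; elim: m H => [|m IH] H cutS; first by exists (fun=> 0).
have Sc : 0 < #|S| by rewrite card_gt0.
have [|F FH [cF Fc]] := @small_connected_subset H S Sn.
  move=> A SA SnA; rewrite -card_gt0; apply: leq_trans (cutS A SA SnA).
  by rewrite muln_gt0.
have [|col colP] := IH (H :\: F).
  move=> A SA SnA; have := cutS A SA SnA; rewrite mulSn => le.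
  have -> : hcut (H :\: F) S A = hcut H S A :\: F.
    by apply/setP=> i; rewrite !inE -!andbA.
  rewrite -(leq_add2l #|S|) (leq_trans le) // -(cardsID F (hcut H S A)).
  by rewrite leq_add2r (leq_trans _ Fc) // subset_leq_card // subsetIr.
(* [F] receives the new colour [m]. The smaller colours connect [S] by hyperedges of [H :\: F],
   which keep their colour. *)
exists (fun i => if i \in F then m else col i) => c.
rewrite ltnS leq_eqVlt => /orP[/eqP ->|cm].
  apply: hconnected_mono cF => i iF _.
  by rewrite inE iF (subsetP FH) //= eqxx.
apply: hconnected_mono (colP c cm) => i; rewrite !inE => /andP[/andP[iF iH] ic] _.
by rewrite iH (negPf iF).
Qed.

End Hypergraph.

(** * Separators from tree decompositions *)

Definition connected_in (V : finType) (e : rel V) (Z : {set V}) :=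
  forall A : {set V}, Z :&: A != set0 -> Z :\: A != set0 ->
  exists a b, [/\ a \in Z :&: A, b \in Z :\: A & e a b].

Section Treewidth.
Variables (G D : sgraph) (B : D -> {set G}).
Hypothesis tdB : tree_decomposition B.

(** The nodes whose bags meet a connected [Z] form a connected part of the tree, phrased as
    propagation of a closed set [C]. For a single vertex this is the subtree axiom ([one]); an edge
    inside [Z] carries it on, since some bag contains both ends. *)
Lemma bags_of_connected (Z : {set G}) (C : {set D}) i z :
  connected_in (@sedge G) Z ->
  (forall a b, sedge a b -> a \in C -> B a :&: Z != set0 ->
     B b :&: Z != set0 -> b \in C) ->
  z \in Z -> z \in B i -> i \in C ->
  forall j, B j :&: Z != set0 -> j \in C.
Proof.
case: tdB => _ _ bagE bagC cZ clC zZ zi iC.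
have one v a b : v \in Z -> v \in B a -> a \in C -> v \in B b -> b \in C.
  move=> vZ va aC vb.
  have cl : closed [rel x y | [&& sedge x y, v \in B x & v \in B y]] (mem C).
    have imp x y : [&& sedge x y, v \in B x & v \in B y] -> x \in C -> y \in C.
      move=> /and3P[xy vx vy] xC; apply: clC xy xC _ _; apply/set0Pn;
        by exists v; rewrite inE vZ ?vx ?vy.
    apply: intro_closed; last exact: imp.
    apply: sym_connect_sym => x y /=.
    by rewrite sedge_sym [(v \in B y) && _]andbC.
  by have := closed_connect cl (bagC v a b va vb); rewrite /= aC => <-.
pose A := [set v | [exists a, (a \in C) && (v \in B a)]].
have ZA : Z :\: A == set0.
  apply/negPn/negP=> ZnA.
  have [|a [b [/setIP[aZ] ]]] := cZ A _ ZnA.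
    apply/set0Pn; exists z; rewrite !inE zZ; apply/existsP; exists i.
    by rewrite iC zi.
  rewrite inE => /existsP[x /andP[xC ax]] /setDP[bZ].
  rewrite inE => /existsP nb ab; have [y /andP[ay b_y]] := bagE a b ab.
  by case: nb; exists y; rewrite b_y (one a x y).
move=> j /set0Pn[v /setIP[vj vZ]].
have : v \in A.
  by move/eqP/setP/(_ v): ZA; rewrite !inE vZ andbT => /negbFE.
by rewrite inE => /existsP[a /andP[aC va]]; apply: one vZ va aC vj.
Qed.

(** Thus [Y] consists of [x] and a union of branches of the tree at [x]. *)
Definition gate (Y : {set D}) x :=
  (x \in Y) && [forall a in Y, (a != x) ==> [forall b, sedge a b ==> (b \in Y)]].

Lemma gateP (Y : {set D}) x : gate Y x ->
  x \in Y /\ forall a b, a \in Y -> a != x -> sedge a b -> b \in Y.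
Proof.
case/andP=> xY /forall_inP gY; split=> // a b aY ax ab.
by have /implyP/(_ ax)/forallP/(_ b)/implyP/(_ ab) := gY a aY.
Qed.

(** If [a] and [b] differed, a simple path between them avoiding [x] would close up through [x] to a
    cycle. *)
Lemma unique_neighbour_in_branch x a b :
  connect [rel u v : D | [&& sedge u v, u != x & v != x]] a b ->
  a != x -> sedge x a -> sedge x b -> a = b.
Proof.
case: tdB => -[_ _ acyc] _ _ _ /connectP[p pP ->] ax xa.
case: (shortenP pP) => p' p'P up' _ xb {p pP}.
case: p' p'P up' xb => [//|y p] pP up xb.
case: (acyc [:: x, a, y & p]) => //; rewrite /ucycle /ucycleb /cycle.
have pD : path (@sedge D) a (y :: p).
  by apply: sub_path pP => u v /and3P[].
have nx : x \notin (a :: y :: p).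
  rewrite inE eq_sym (negPf ax) /=.
  move: pP; clear -ax; move: (y :: p) => s; elim: s a ax => [//|c s IH] d dx /=.
  case/andP=> /and3P[_ _ cx] /(IH c cx); rewrite inE negb_or => ->.
  by rewrite eq_sym cx.
rewrite [uniq _]cons_uniq nx up rcons_path /= xa.
by move: pD xb => /= -> xb; rewrite sedge_sym xb.
Qed.

(* The pair (bag, vertices behind it) is read off a minimal set [Y] of nodes
   that can be left only through one node and that contains all the nodes
   whose bags meet some [Z j]. *)
Lemma tree_decomposition_separator (J : finType) (K : {set J}) (Z : J -> {set G}) :
  K != set0 -> (forall j, j \in K -> connected_in (@sedge G) (Z j)) ->
  exists j0 x (U : {set G}),
   [/\ j0 \in K, Z j0 \subset U,
       forall z b, z \in Z j0 -> sedge z b -> b \in U,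
       forall a b, a \in U -> a \notin B x -> sedge a b -> b \in U
     & forall j, j \in K -> Z j :&: U != set0 -> Z j :&: B x != set0].
Proof.
move=> Kn cZ; case: (tdB) => -[Dn _ _] bagV bagE _.
pose nodes j := [set i | B i :&: Z j != set0].
pose P Y := [exists x, gate Y x] && [exists j in K, nodes j \subset Y].
have /minset_exists[Y /minsetP[/andP[/existsP[x gYx] /exists_inP[j0 j0K jY]] minY] _] :
    P [set: D].
  have /set0Pn[x _] := Dn; have /set0Pn[j jK] := Kn.
  apply/andP; split; last by apply/exists_inP; exists j; rewrite ?subsetT.
  apply/existsP; exists x; rewrite /gate inE /=; apply/forall_inP=> a _.
  by apply/implyP=> _; apply/forallP=> b; rewrite inE implybT.
have [xY clY] := gateP gYx.
exists j0, x, (\bigcup_(i in Y) B i); split=> //.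
- apply/subsetP=> z zZ; have [i zi] := bagV z.
  apply/bigcupP; exists i => //; apply: (subsetP jY); rewrite inE.
  by apply/set0Pn; exists z; rewrite inE zi.
- move=> z b zZ zb; have [i /andP[zi bi]] := bagE z b zb.
  apply/bigcupP; exists i => //; apply: (subsetP jY); rewrite inE.
  by apply/set0Pn; exists z; rewrite inE zi.
- move=> a b /bigcupP[i iY ai] ax ab.
  have [j /andP[aj bj]] := bagE a b ab.
  apply/bigcupP; exists j => //.
  (* The nodes whose bags contain [a] form a subtree that avoids [x], the only exit of [Y]; hence
     the bag of the edge [ab] belongs to [Y]. *)
  apply: (@bags_of_connected [set a] Y i a) => //; rewrite ?inE //.
  + move=> A /set0Pn[u /setIP[/set1P -> aA]] /set0Pn[w /setDP[/set1P ->]].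
    by rewrite aA.
  + move=> u v uv uY /set0Pn[w /setIP[wu /set1P wa]] _; subst w.
    by apply: clY uY _ uv; apply: contraNneq ax => <-.
  by apply/set0Pn; exists a; rewrite !inE aj eqxx.
move=> j jK /set0Pn[z /setIP[zZ /bigcupP[i iY zi]]].
apply/negP=> /eqP Zx0.
pose e := [rel u v : D | [&& sedge u v, u != x & v != x]].
have ix : i != x.
  by apply/eqP=> ix; subst i; move/setP/(_ z): Zx0; rewrite !inE zZ zi.
(* If [Z j] misses the bag of [x], all nodes meeting it lie in one branch [C] of [Y] at [x]. This
   branch is again gated and omits [x], against the minimality of [Y]. *)
pose C := [set y | connect e i y].
have iC : i \in C by rewrite inE connect0.
have esym : connect_sym e.
  by apply: sym_connect_sym => u v /=; rewrite sedge_sym [(v != x) && _]andbC.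
have CY : C \subset Y :\ x.
  apply/subsetP=> y; rewrite inE => iy.
  have cl : closed e (mem (Y :\ x)).
    apply: intro_closed => // u v /and3P[uv ux vx]; rewrite !inE => /andP[_ uY].
    by rewrite vx (clY u v).
  by have := closed_connect cl iy; rewrite !inE ix iY => <-.
have Cx y : y \in C -> y != x by move/(subsetP CY); rewrite !inE => /andP[].
have Cstep u v : u \in C -> v != x -> sedge u v -> v \in C.
  move=> uC vx uv; move: (uC); rewrite !inE => iu.
  by apply: connect_trans iu (connect1 _); rewrite /= uv vx Cx.
have nC : nodes j \subset C.
  apply/subsetP=> y; rewrite inE.
  apply: (@bags_of_connected (Z j) C i z) => //; first exact: cZ.
  move=> u v uv uC _ vZ; apply: Cstep uv => //; apply/eqP=> vx.
  by subst v; move: vZ; rewrite setIC Zx0 eqxx.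
have PC : P C.
  apply/andP; split; last by apply/exists_inP; exists j.
  have mk y : y \in C -> (forall a, a \in C -> a != y -> ~~ sedge a x) ->
      [exists y, gate C y].
    move=> yC H; apply/existsP; exists y; rewrite /gate yC /=.
    apply/forall_inP=> a aC; apply/implyP=> ay; apply/forallP=> b.
    apply/implyP=> ab; apply: Cstep (ab) => //; apply/eqP=> bx.
    by have := H a aC ay; rewrite -bx ab.
  (* The gate of [C] is its unique neighbour of [x], or any node if there is no such neighbour. *)
  have [/exists_inP[y yC yx]|/exists_inP no] := boolP [exists y in C, sedge y x].
    apply: (mk y yC) => a aC; apply: contra => ax; apply/eqP.
    apply: (@unique_neighbour_in_branch x); rewrite ?Cx // 1?sedge_sym //.
    apply: (@connect_trans _ _ i); last by move: yC; rewrite inE.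
    by rewrite esym; move: aC; rewrite inE.
  by apply: (mk i iC) => a aC _; apply/negP=> ax; apply: no; exists a.
have CsubY : C \subset Y by apply: subset_trans CY (subsetDl _ _).
have E := minY C PC CsubY.
by move: xY; rewrite -E => /Cx; rewrite eqxx.
Qed.

End Treewidth.

(** * Uncrossing element cuts *)

Section Cuts.
Variables (V : finType) (T : {set V}) (k : nat).
Implicit Types (e : rel V) (A B : {set V}).

(** The size of an element cut: the vertices on neither side and the edges from [A] to [B] are
    removed. For disjoint [A] and [B] and symmetric [e], the ordered pairs count each such edge
    once. *)
Definition cutval e A B :=
  \sum_(x : V) ((x \notin A) && (x \notin B)) +
  \sum_(p : V * V) [&& p.1 \in A, p.2 \in B & e p.1 p.2].

(** Covering [T] ensures that only non-terminals are removed as vertices. *)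
Definition separates A B :=
  [/\ [disjoint A & B], T \subset A :|: B, T :&: A != set0 & T :&: B != set0].

Definition cut_connected e := forall A B, separates A B -> k <= cutval e A B.

Lemma separatesC A B : separates A B -> separates B A.
Proof. by case=> ? ? ? ?; split; rewrite // 1?disjoint_sym // setUC. Qed.

Lemma cutvalC e A B : symmetric e -> cutval e A B = cutval e B A.
Proof.
move=> se; rewrite /cutval; congr (_ + _).
  by apply: eq_bigr => x _; rewrite andbC.
rewrite (reindex_inj (can_inj (@swap_pairK V V))) /=; apply: eq_bigr => -[x y] _ /=.
by rewrite se andbCA.
Qed.

Lemma separates_uncross A1 B1 A2 B2 :
  separates A1 B1 -> separates A2 B2 ->
  T :&: (A1 :&: A2) != set0 -> T :&: (B1 :&: B2) != set0 ->
  separates (A1 :&: A2) (B1 :|: B2) /\ separates (A1 :|: A2) (B1 :&: B2).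
Proof.
move=> [d1 t1 a1 b1] [d2 t2 a2 b2] nA nB.
have D A B : [disjoint A & B] -> forall x, x \in A -> x \in B -> False.
  by move=> /pred0P dAB x xA xB; have := dAB x; rewrite /= xA xB.
have sep (x : V) : x \in T -> ((x \in A1) || (x \in B1)) && ((x \in A2) || (x \in B2)).
  by move=> xT; rewrite -!in_setU !(subsetP _ x xT).
split; split=> //.
- apply/pred0P=> x /=; rewrite !inE; apply/negP=> /andP[/andP[x1 x2] /orP[] xB].
    exact: D d1 x x1 xB.
  exact: D d2 x x2 xB.
- apply/subsetP=> x /sep; rewrite !inE.
  by case: (x \in A1); case: (x \in A2); case: (x \in B1); case: (x \in B2).
- apply: contraNneq nB => nB; rewrite -subset0 -nB; apply: setIS.
  by apply/subsetP=> x; rewrite !inE => /andP[->].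
- apply/pred0P=> x /=; rewrite !inE; apply/negP=> /andP[/orP[] x1 /andP[y1 y2]].
    exact: D d1 x x1 y1.
  exact: D d2 x x1 y2.
- apply/subsetP=> x /sep; rewrite !inE.
  by case: (x \in A1); case: (x \in A2); case: (x \in B1); case: (x \in B2).
- apply: contraNneq nA => nA; rewrite -subset0 -nA; apply: setIS.
  by apply/subsetP=> x; rewrite !inE => /andP[->].
Qed.

(** Submodularity, checked element by element. It is strict because the pair [(p, q)] counts in the
    first cut but in neither of the uncrossed ones. *)
Lemma cutval_uncross e A1 B1 A2 B2 p q :
  [disjoint A1 & B1] -> [disjoint A2 & B2] ->
  e p q -> p \in A1 -> q \in B1 -> p \notin A2 -> q \notin B2 ->
  cutval e (A1 :&: A2) (B1 :|: B2) + cutval e (A1 :|: A2) (B1 :&: B2) <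
  cutval e A1 B1 + cutval e A2 B2.
Proof.
move=> d1 d2 epq pA qB pA2 qB2; rewrite /cutval.
have lv : \sum_x ((x \notin A1 :&: A2) && (x \notin B1 :|: B2)) +
          \sum_x ((x \notin A1 :|: A2) && (x \notin B1 :&: B2)) <=
          \sum_x ((x \notin A1) && (x \notin B1)) +
          \sum_x ((x \notin A2) && (x \notin B2)).
  rewrite -!big_split /=; apply: leq_sum => x _.
  move/pred0P/(_ x): d1; move/pred0P/(_ x): d2; rewrite !inE /=.
  by case: (x \in A1); case: (x \in A2); case: (x \in B1); case: (x \in B2).
have le : \sum_(x : V * V) [&& x.1 \in A1 :&: A2, x.2 \in B1 :|: B2 & e x.1 x.2] +
          \sum_(x : V * V) [&& x.1 \in A1 :|: A2, x.2 \in B1 :&: B2 & e x.1 x.2] <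
          \sum_(x : V * V) [&& x.1 \in A1, x.2 \in B1 & e x.1 x.2] +
          \sum_(x : V * V) [&& x.1 \in A2, x.2 \in B2 & e x.1 x.2].
  rewrite -!big_split /= (bigD1 (p, q)) //= [ltnRHS](bigD1 (p, q)) //=.
  rewrite !inE pA qB epq (negPf pA2) (negPf qB2) /= add0n add1n ltnS.
  apply: leq_sum => -[x y] _ /=; rewrite !inE.
  by case: (x \in A1); case: (x \in A2); case: (y \in B1); case: (y \in B2); case: (e x y).
by rewrite addnACA [ltnRHS]addnACA -addnS; apply: leq_add.
Qed.

(** Uncrossing the first cut with the second, or with the second reversed, gives two cuts of total
    value below [2k], although each has value at least [k]. *)
Lemma no_crossing_tight_cuts e A1 B1 A2 B2 p q :
  symmetric e -> cut_connected e -> separates A1 B1 -> separates A2 B2 ->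
  cutval e A1 B1 <= k -> cutval e A2 B2 <= k ->
  e p q -> p \in A1 -> q \in B1 ->
  p \notin A2 -> p \notin B2 -> q \notin A2 -> q \notin B2 -> False.
Proof.
move=> se ce s1 s2 c1 c2 epq pA qB pA2 pB2 qA2 qB2.
have uncross A B : separates A B -> cutval e A B <= k -> p \notin A -> q \notin B ->
    T :&: (A1 :&: A) != set0 -> T :&: (B1 :&: B) != set0 -> False.
  move=> s c pA' qB' nA nB; have [u1 u2] := separates_uncross s1 s nA nB.
  case: (s1) (s) => [d1 _ _ _] [d _ _ _].
  have lt := cutval_uncross d1 d epq pA qB pA' qB'.
  have := leq_ltn_trans (leq_add (ce _ _ u1) (ce _ _ u2)) lt.
  by rewrite ltnNge leq_add.
case: (s1) (s2) => [_ t1 /set0Pn[a /setIP[aT aA]] /set0Pn[b /setIP[bT bB]]].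
move=> [_ t2 /set0Pn[c /setIP[cT cA]] /set0Pn[d /setIP[dT dB]]].
have nz A B x : x \in T -> x \in A -> x \in B -> T :&: (A :&: B) != set0.
  by move=> xT xA xB; apply/set0Pn; exists x; rewrite !inE xT xA xB.
have in1 x : x \in T -> (x \in A1) || (x \in B1) by move/(subsetP t1); rewrite inE.
have in2 x : x \in T -> (x \in A2) || (x \in B2) by move/(subsetP t2); rewrite inE.
have c2' : cutval e B2 A2 <= k by rewrite cutvalC.
have dir x y := uncross A2 B2 s2 c2 pA2 qB2 x y.
have rev x y := uncross B2 A2 (separatesC s2) c2' pB2 qA2 x y.
(* All four sides contain terminals, so in the two-by-two table of their intersections one diagonal
   has terminals in both entries; it decides whether the second cut is reversed. *)
case/orP: (in2 a aT) => a2; case/orP: (in2 b bT) => b2.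
- case/orP: (in1 d dT) => d1; first exact: rev (nz _ _ d _ _ _) (nz _ _ b _ _ _).
  exact: dir (nz _ _ a _ _ _) (nz _ _ d _ _ _).
- exact: dir (nz _ _ a _ _ _) (nz _ _ b _ _ _).
- exact: rev (nz _ _ a _ _ _) (nz _ _ b _ _ _).
- case/orP: (in1 c cT) => c1'; first exact: dir (nz _ _ c _ _ _) (nz _ _ b _ _ _).
  exact: rev (nz _ _ a _ _ _) (nz _ _ c _ _ _).
Qed.

Definition delete_edge e p q : rel V :=
  fun x y => e x y && ~~ ((x == p) && (y == q) || (x == q) && (y == p)).

(* The contracted vertex is [p]; [q] stays in the graph as an isolated vertex. *)
Definition contract_edge e p q : rel V :=
  fun x y => [&& x != y, x != q, y != q &
    [|| e x y, (x == p) && e q y | (y == p) && e x q]].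

Lemma delete_edge_sym e p q : symmetric e -> symmetric (delete_edge e p q).
Proof. by move=> se x y; rewrite /delete_edge se orbC ![(y == _) && _]andbC. Qed.

Lemma contract_edge_sym e p q : symmetric e -> symmetric (contract_edge e p q).
Proof.
move=> se x y; rewrite /contract_edge eq_sym (se x y) (se q y) (se x q).
by rewrite [(x != q) && _]andbCA [((x == p) && _) || _]orbC.
Qed.

Lemma sum_nat_eq (I : finType) (i : I) : \sum_(j : I) (j == i : nat) = 1.
Proof. by rewrite (bigD1 i) //= eqxx big1 // => j /negPf ->. Qed.

(** Deleting [pq] lowers a cut value by at most one, and only if [p] and [q] lie on opposite
    sides. *)
Lemma failing_deletion_cut e p q :
  symmetric e -> cut_connected e -> ~ cut_connected (delete_edge e p q) ->
  exists A B, [/\ separates A B, cutval e A B <= k, p \in A & q \in B].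
Proof.
move=> se ce /existsNP[A /existsNP[B /not_implyP[sAB /negP]]].
rewrite -ltnNge => lt.
have main A' B' : separates A' B' -> cutval (delete_edge e p q) A' B' < k ->
    p \in A' -> q \in B' -> cutval e A' B' <= k.
  move=> s lt' pA qB; apply: leq_trans lt'; rewrite -addn1 /cutval -addnA leq_add2l.
  rewrite -(sum_nat_eq (p, q)) -big_split /=; apply: leq_sum => -[x y] _ /=.
  rewrite /delete_edge xpair_eqE; case: s => d _ _ _.
  case: (boolP (x \in A')) => //= xA; case: (boolP (y \in B')) => //= yB.
  have -> : (x == q) = false.
    by apply/eqP=> xq; subst x; move/pred0P/(_ q): d; rewrite /= xA qB.
  by case: (e x y) => //=; case: (_ && _).
have [/andP[pA qB]|n1] := boolP ((p \in A) && (q \in B)).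
  by exists A, B; split=> //; exact: main.
have [/andP[pB qA]|n2] := boolP ((p \in B) && (q \in A)).
  exists B, A; split=> //; first exact: separatesC.
  by apply: main => //; [exact: separatesC | rewrite cutvalC //; exact: delete_edge_sym].
suff E : cutval e A B = cutval (delete_edge e p q) A B.
  by move: lt; rewrite -E ltnNge ce.
congr (_ + _); apply: eq_bigr => -[x y] _ /=; congr nat_of_bool.
rewrite /delete_edge; case: (boolP (x \in A)) => //= xA.
case: (boolP (y \in B)) => //= yB; case: (e x y) => //=; apply/esym/negP.
case/orP=> /andP[/eqP xE /eqP yE]; subst x y; first by rewrite xA yB in n1.
by rewrite xA yB in n2.
Qed.

(** A deficient cut of the contracted graph is lifted to the original one by removing both [p] and
    [q]; the cases show that this costs at most one. *)
Lemma failing_contraction_cut e p q :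
  symmetric e -> irreflexive e -> e p q -> p \notin T -> q \notin T ->
  cut_connected e -> ~ cut_connected (contract_edge e p q) ->
  exists A B, [/\ separates A B, cutval e A B <= k &
    [&& p \notin A, p \notin B, q \notin A & q \notin B]].
Proof.
move=> se ie epq pT qT ce /existsNP[A0 /existsNP[B0 /not_implyP[sAB0 /negP]]].
rewrite -ltnNge => lt0.
(* After exchanging the sides if necessary, [p] is not in [B]. *)
have [A [B [sAB lt pB]]] : exists A B, [/\ separates A B,
    cutval (contract_edge e p q) A B < k & p \notin B].
  have [pB|pB] := boolP (p \in B0); last by exists A0, B0.
  exists B0, A0; split; first exact: separatesC.
    by rewrite cutvalC //; exact: contract_edge_sym.
  by case: sAB0 => /pred0P/(_ p)/=; rewrite pB andbT => ->.
case: (sAB) => d t nA nB.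
have Tp x : x \in T -> x != p by move=> xT; apply: contraNneq pT => <-.
have Tq x : x \in T -> x != q by move=> xT; apply: contraNneq qT => <-.
have dAB x : x \in A -> x \in B -> False.
  by move=> xA xB; move/pred0P/(_ x): d; rewrite /= xA xB.
have sep' : separates (A :\ p :\ q) (B :\ q).
  split.
  - by apply/pred0P=> x /=; rewrite !inE; apply/negP=> /andP[/and3P[_ _ /dAB xA] /andP[_]].
  - apply/subsetP=> x xT; have := subsetP t x xT.
    by rewrite !inE (negPf (Tq x xT)) (negPf (Tp x xT)).
  - case/set0Pn: nA => x /setIP[xT xA]; apply/set0Pn; exists x.
    by rewrite !inE xT xA Tp ?Tq.
  - case/set0Pn: nB => x /setIP[xT xA]; apply/set0Pn; exists x.
    by rewrite !inE xT xA Tq.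
have out : [&& p \notin A :\ p :\ q, p \notin B :\ q, q \notin A :\ p :\ q & q \notin B :\ q].
  by rewrite !inE !eqxx (negPf pB) /= !andbF.
(* If [p] is in [A] and the contracted vertex has no edge to [B], then moving [q] to the side of [A]
   gives a cut of [e] below [k], which is impossible. *)
have [/andP[pA /existsP no]|no] :=
    boolP ((p \in A) && ~~ [exists y in B, contract_edge e p q p y]).
  suff le : cutval e (q |: A) (B :\ q) <= cutval (contract_edge e p q) A B.
    have : separates (q |: A) (B :\ q).
      split.
      - by apply/pred0P=> x /=; rewrite !inE; case: eqP => //= _; apply/negP=> /andP[/dAB dx /dx].
      - apply/subsetP=> x xT; have := subsetP t x xT.
        by rewrite !inE (negPf (Tq x xT)).
      - case/set0Pn: nA => x /setIP[xT xA]; apply/set0Pn; exists x.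
        by rewrite !inE xT xA orbT.
      - case/set0Pn: nB => x /setIP[xT xA]; apply/set0Pn; exists x.
        by rewrite !inE xT xA Tq.
    by move/ce => /leq_trans/(_ le); rewrite leqNgt lt.
  rewrite /cutval; apply: leq_add; apply: leq_sum.
    by move=> x _; rewrite !inE; case: (x == q) => //=; case: (x \in A); case: (x \in B).
  move=> [x y] _ /=; rewrite !inE.
  case: (boolP (y == q)) => [_|yq]; first by rewrite andbF.
  case: (boolP (y \in B)) => [yB|_]; last by rewrite !andbF.
  rewrite /=; case: (boolP (e x y)) => [exy|_]; last by rewrite andbF.
  have yp : y != p by apply: contraNneq pB => <-.
  have nop : (x == p) || (x == q) -> False.
    move=> xpq; apply: no; exists y; rewrite yB /contract_edge eqxx eq_sym yp yq /=.
    have -> : p != q by apply: contraTneq epq => ->; rewrite ie.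
    by case/orP: xpq => /eqP <-; rewrite exy ?orbT.
  have [xp xq] : x != p /\ x != q by split; apply/negP=> E; apply: nop; rewrite E ?orbT.
  have xy : x != y by apply: contraTneq exy => ->; rewrite ie.
  by rewrite /contract_edge (negPf xq) /= xy yq exy.
exists (A :\ p :\ q), (B :\ q); split=> //; apply: leq_trans lt.
have edge_le x y : [&& x \in A :\ p :\ q, y \in B :\ q & e x y] ->
    [&& x \in A, y \in B, x != p & contract_edge e p q x y].
  rewrite !inE => /and3P[/and3P[xq xp xA] /andP[yq yB] exy].
  rewrite xA yB xp /contract_edge xq yq exy /= andbT.
  by apply: contraTneq exy => ->; rewrite ie.
(* Here [p] was removed already, so at most [q] is newly removed. *)
have [pA|pA] := boolP (p \in A); last first.
  rewrite -addn1 addnAC; apply: leq_add.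
    rewrite -(sum_nat_eq q) -big_split; apply: leq_sum => x _ /=; rewrite !inE.
    have [->|xq] := eqVneq x q; first by rewrite addn1.
    have [->|xp] := eqVneq x p; first by rewrite pA pB.
    by rewrite addn0.
  apply: leq_sum => -[x y] _ /=; case: (boolP [&& _, _ & _]) => // /edge_le.
  by case/and4P=> -> -> _ ->.
(* In the last case at most two vertices are newly removed, while the edge from [p] to [y0] is
   saved. *)
move: no; rewrite pA negbK => /exists_inP[y0 y0B py0].
have v_le : \sum_(x : V) ((x \notin A :\ p :\ q) && (x \notin B :\ q)) <=
    \sum_(x : V) ((x \notin A) && (x \notin B)) + 2.
  have -> : 2 = \sum_(x : V) (x == p : nat) + \sum_(x : V) (x == q : nat).
    by rewrite !sum_nat_eq.
  rewrite -!big_split; apply: leq_sum => x _ /=; rewrite !inE.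
  by case: (x == q); case: (x == p); case: (x \in A); case: (x \in B).
have e_le : \sum_(x : V * V) [&& x.1 \in A :\ p :\ q, x.2 \in B :\ q & e x.1 x.2] <
    \sum_(x : V * V) [&& x.1 \in A, x.2 \in B & contract_edge e p q x.1 x.2].
  rewrite -addn1 -(sum_nat_eq (p, y0)) -big_split; apply: leq_sum => -[x y] _ /=.
  rewrite xpair_eqE; have [->|xp] := eqVneq x p.
    rewrite !inE eqxx /= andbF add0n.
    by have [->|//] := eqVneq y y0; rewrite pA y0B py0.
  rewrite addn0; case: (boolP [&& _, _ & _]) => // /edge_le.
  by case/and4P=> -> -> _ ->.
by rewrite -ltnS -addnS (leq_trans (leq_add v_le e_le)) // addnAC addn2.
Qed.

Lemma delete_or_contract e p q :
  symmetric e -> irreflexive e -> e p q -> p \notin T -> q \notin T ->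
  cut_connected e ->
  cut_connected (delete_edge e p q) \/ cut_connected (contract_edge e p q).
Proof.
move=> se ie epq pT qT ce; apply: contrapT => /not_orP[n1 n2].
have [A1 [B1 [s1 c1 pA qB]]] := failing_deletion_cut se ce n1.
have [A2 [B2 [s2 c2 /and4P[x1 x2 x3 x4]]]] :=
  failing_contraction_cut se ie epq pT qT ce n2.
exact: (no_crossing_tight_cuts se ce s1 s2 c1 c2 epq).
Qed.
End Cuts.

(** * Reduction to a hypergraph on the terminals *)

Section Reduction.
Variables (V : finType) (T : {set V}) (k : nat).
Implicit Types (e : rel V) (U : {set V}) (H : {set {set V}}).

Definition terminals_of U := U :&: T.

(** In the second form [U :\: T] is nonempty, since the terminal that [U] contains has a neighbour
    there. *)
Definition is_hyperedge e U :=
  terminals_of U != set0 /\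
  ((exists x y, [/\ U = [set x; y], x \in T, y \in T & e x y]) \/
   (connected_in e (U :\: T) /\
    forall u, u \in U :&: T -> exists2 w, w \in U :\: T & e w u)).

(** Hyperedges are indexed by their vertex sets in the graph, so that several with the same
    terminals count separately in a cut. *)
Definition hyperedge_system e H :=
  [/\ forall U, U \in H -> is_hyperedge e U,
      forall U U', U \in H -> U' \in H -> U != U' -> U :&: U' \subset T
    & forall A, T :&: A != set0 -> T :\: A != set0 ->
        k <= #|hcut terminals_of H T A|].

Lemma connected_in_mono e e' (Z : {set V}) :
  subrel e e' -> connected_in e Z -> connected_in e' Z.
Proof.
move=> ee' cZ A ZA ZnA; have [a [b [aZ bZ /ee' ab]]] := cZ A ZA ZnA.
by exists a, b.
Qed.

Lemma hyperedge_system_mono e e' H :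
  subrel e e' -> hyperedge_system e H -> hyperedge_system e' H.
Proof.
move=> ee' [hH dH cH]; split=> // U /hH[nU [[x [y [-> xT yT xy]]]|[cU aU]]].
  split; first by apply/set0Pn; exists x; rewrite !inE eqxx.
  by left; exists x, y; split; rewrite // ee'.
split=> //; right; split; first exact: connected_in_mono cU.
by move=> u /aU[w wU wu]; exists w => //; apply: ee'.
Qed.

Lemma sum_nat_of_bool (J : finType) (P : pred J) :
  \sum_(i : J) (P i : nat) = #|[set i | P i]|.
Proof.
rewrite -sum1_card [RHS]big_mkcond /=; apply: eq_bigr => i _.
by rewrite inE; case: (P i).
Qed.

(** Without edges between non-terminals, the stars of the non-terminals and the edges inside [T]
    serve as hyperedges. *)
Lemma hyperedge_system_bipartite e :
  symmetric e -> (forall p q, e p q -> (p \in T) || (q \in T)) ->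
  cut_connected T k e -> exists H, hyperedge_system e H.
Proof.
move=> se bip ce.
pose nbh w := [set u in T | e w u].
pose H1 := [set w |: nbh w | w in [set w | (w \notin T) && (nbh w != set0)]].
pose H2 := [set [set p.1; p.2] | p in [set p : V * V | [&& p.1 \in T, p.2 \in T & e p.1 p.2]]].
have nbhT w : w \notin T -> (w |: nbh w) :&: T = nbh w.
  move=> wT; apply/setP=> x; rewrite !inE.
  by have [->|_] /= := eqVneq x w; rewrite ?(negPf wT) // andbAC andbb.
have nbhD w : w \notin T -> (w |: nbh w) :\: T = [set w].
  move=> wT; apply/setP=> x; rewrite !inE.
  by have [->|_] /= := eqVneq x w; [rewrite wT | case: (x \in T)].
exists (H1 :|: H2); split.
- move=> U /setUP[] /imsetP[].
    move=> w; rewrite inE => /andP[wT nw] ->.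
    rewrite /is_hyperedge /terminals_of nbhT // nbhD //; split=> //; right.
    split.
      move=> A /set0Pn[x /setIP[/set1P -> wA]] /set0Pn[y /setDP[/set1P ->]].
      by rewrite wA.
    by move=> u; rewrite inE => /andP[uT wu]; exists w; rewrite ?inE.
  move=> [x y]; rewrite inE /= => /and3P[xT yT xy] ->.
  split; last by left; exists x, y.
  by apply/set0Pn; exists x; rewrite !inE eqxx.
- have H2T U : U \in H2 -> U \subset T.
    move=> /imsetP[[x y]]; rewrite inE /= => /and3P[xT yT _] ->.
    by apply/subsetP=> z; rewrite !inE => /orP[] /eqP ->.
  move=> U U' /setUP[UH|/H2T UT] /setUP[UH'|/H2T UT'] UU'; first last.
  + exact: subset_trans (subsetIl _ _) UT.
  + exact: subset_trans (subsetIl _ _) UT.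
  + exact: subset_trans (subsetIr _ _) UT'.
  case/imsetP: UH UU' => w; rewrite inE => /andP[wT _] ->.
  case/imsetP: UH' => w'; rewrite inE => /andP[wT' _] -> ww'.
  apply/subsetP=> z; rewrite !inE => /andP[/orP[/eqP ->|/andP[] //]].
  case/orP=> [/eqP E|/andP[] //].
  by rewrite E eqxx in ww'.
move=> A TA TnA.
pose tA w := [exists u in T :&: A, e w u].
pose tB w := [exists u in T :\: A, e w u].
(* A non-terminal joins the side of its terminal neighbours, [A'] if it has none, and is removed if
   it sees both sides. The removed vertices then give crossing stars, and the cut edges are crossing
   edges inside [T]. *)
pose A' := (T :&: A) :|: [set w | (w \notin T) && ~~ tB w].
pose B' := (T :\: A) :|: [set w | [&& w \notin T, tB w & ~~ tA w]].
have sep : separates T A' B'.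
  split.
  - apply/pred0P=> x /=; rewrite !inE.
    by case: (x \in T); case: (x \in A); case: (tB x).
  - by apply/subsetP=> x xT; rewrite !inE xT; case: (x \in A).
  - case/set0Pn: TA => x /setIP[xT xA]; apply/set0Pn; exists x.
    by rewrite !inE xT xA.
  - case/set0Pn: TnA => x /setDP[xT xA]; apply/set0Pn; exists x.
    by rewrite !inE xT (negPf xA).
have := ce _ _ sep; rewrite /cutval !sum_nat_of_bool.
set X := [set x | _ && _]; set E := [set p | _].
have XP w : w \in X -> [/\ w \notin T, tA w & tB w].
  rewrite !inE; case: (w \in T); case: (w \in A); case: (tA w); case: (tB w) => //=.
have EP p : p \in E -> [/\ p.1 \in T :&: A, p.2 \in T :\: A & e p.1 p.2].
  case: p => x y; rewrite inE /= => /and3P[xA yB xy]; move: xA yB.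
  move: (bip x y xy); rewrite /A' /B' !inE.
  have [xT|xT] := boolP (x \in T); have [yT|yT] := boolP (y \in T) => //= _;
    rewrite ?andbT ?andbF ?orbF //=.
    move=> xA /andP[_ /exists_inP[]]; exists x; rewrite ?inE ?xT // 1?se //.
  move=> /exists_inP nB yA; case: nB; exists y; rewrite ?inE ?yT ?yA //.
move=> kXE; apply: leq_trans kXE _.
have i1 : {in X &, injective (fun w => w |: nbh w)}.
  move=> w w' /XP[wT _ _] /XP[wT' _ _] /(congr1 (fun S => S :\: T)).
  by rewrite !nbhD // => /set1_inj.
have i2 : {in E &, injective (fun p : V * V => [set p.1; p.2])}.
  move=> [x y] [x' y'] /EP[/= xA yA _] /EP[/= xA' yA' _] /setP Eq.
  have := Eq x; have := Eq y; move: xA yA xA' yA'; rewrite !inE !eqxx orbT /=.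
  move=> /andP[_ xA] /andP[yA _] /andP[_ xA'] /andP[yA' _].
  have /negPf -> : y != x' by apply: contraNneq yA => ->.
  have /negPf -> : x != y' by apply: contraNneq yA' => <-.
  by rewrite orbF /= => /esym/eqP -> /esym/eqP ->.
(* The two counts add up because a star, unlike an edge inside [T], contains a non-terminal. *)
rewrite -(card_in_imset i1) -(card_in_imset i2) -cardsUI.
set Y := _ :&: _; have -> : Y = set0.
  apply/setP=> U; rewrite !inE; apply/negP=> /andP[/imsetP[w /XP[wT _ _] ->]].
  case/imsetP=> -[x y] /EP[/= xT yT _] /setP/(_ w).
  rewrite !inE eqxx /= => /esym/orP[] /eqP wE; subst w; move: wT.
    by case/setIP: xT => ->.
  by case/setDP: yT => ->.
rewrite cards0 addn0; apply: subset_leq_card; apply/subsetP=> U.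
case/setUP=> /imsetP[].
  move=> w /XP[wT wA wB] ->; rewrite !inE /terminals_of /crosses nbhT //.
  case/exists_inP: wA => a; rewrite inE => /andP[aT aA] wa.
  case/exists_inP: wB => b; rewrite inE => /andP[bA bT] wb.
  apply/and3P; split.
  - apply/orP; left; apply/imsetP; exists w => //; rewrite inE wT.
    by apply/set0Pn; exists a; rewrite inE aT.
  - by apply/subsetP=> x; rewrite inE => /andP[].
  - apply/andP; split; apply/set0Pn; first by exists a; rewrite !inE aT wa aA.
    by exists b; rewrite !inE bT wb bA.
move=> [x y] /EP[/= /setIP[xT xA] /setDP[yT yA] xy] ->.
rewrite !inE /terminals_of /crosses subsetIr /=; apply/andP; split.
  by apply/orP; right; apply/imsetP; exists (x, y); rewrite // inE /= xT yT.
apply/andP; split; apply/set0Pn; first by exists x; rewrite !inE eqxx xT xA.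
by exists y; rewrite !inE eqxx orbT yT yA.
Qed.

(** The isolated [q] lies in no hyperedge, and at most one hyperedge contains the non-terminal [p].
    Adding [q] to that one undoes the contraction and leaves all sets of terminals, hence all cuts,
    unchanged. *)
Lemma hyperedge_system_contract e p q H :
  symmetric e -> e p q -> p \notin T -> q \notin T ->
  hyperedge_system (contract_edge e p q) H -> exists H', hyperedge_system e H'.
Proof.
move=> se epq pT qT [hH dH cH].
set e2 := contract_edge e p q in hH.
have e2q x y : e2 x y -> (x != q) && (y != q) by case/and4P=> _ -> ->.
have qH U : U \in H -> q \notin U.
  move=> /hH[nU hU]; apply/negP=> qU; case: hU.
    move=> [x [y [UE xT yT _]]]; move: qU; rewrite UE !inE.
    by case/orP=> /eqP qE; rewrite qE ?xT ?yT in qT.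
  move=> [cU aU]; have [Wq|nWq] := boolP (U :\: T \subset [set q]).
    case/set0Pn: nU => u /aU[w /(subsetP Wq)/set1P ->] /e2q.
    by rewrite eqxx.
  have [||a [b [/setIP[_ /set1P ->] _ /e2q]]] := cU [set q].
  - by apply/set0Pn; exists q; rewrite !inE qU qT eqxx.
  - by rewrite setD_eq0.
  - by rewrite eqxx.
pose phi U := if p \in U then q |: U else U.
have phiT U : phi U :&: T = U :&: T.
  rewrite /phi; case: ifP => // _; apply/setP=> x; rewrite !inE.
  by have [->|] := eqVneq x q; rewrite ?(negPf qT) ?andbF.
have phiK U : U \in H -> phi U :\ q = U.
  move=> /qH qU; have UE : U :\ q = U.
    by apply/setP=> x; rewrite !inE; have [->|] := eqVneq x q; rewrite ?(negPf qU).
  rewrite /phi; case: ifP => // _; rewrite -[RHS]UE; apply/setP=> x; rewrite !inE.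
  by case: (x == q).
have phi_inj : {in H &, injective phi}.
  by move=> U U' UH UH' /(congr1 (fun S => S :\ q)); rewrite !phiK.
exists (phi @: H); split.
- move=> _ /imsetP[U UH ->]; have [nU hU] := hH U UH.
  rewrite /is_hyperedge /terminals_of phiT; split=> //.
  case: hU => [[x [y [UE xT yT]]]|[cU aU]].
    have Np z : z \in T -> z != p by move=> zT; apply: contraNneq pT => <-.
    have pU : (p \in U) = false.
      by rewrite UE !inE ![p == _]eq_sym (negPf (Np x xT)) (negPf (Np y yT)).
    case/and4P=> _ _ _; rewrite (negPf (Np x xT)) (negPf (Np y yT)) !orbF => xy.
    by left; exists x, y; rewrite /phi pU.
  right; split; last first.
    move=> u uU; have [w wU] := aU u uU; have uT : u \in T by case/setIP: uU.
    have up : u != p by apply: contraNneq pT => <-.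
    move=> /and4P[_ _ _]; rewrite (negPf up) orbF /=.
    case/orP=> [wu|/andP[/eqP wp qu]].
      exists w => //; move: wU; rewrite /phi !inE.
      by case: (p \in U) => // /andP[-> wU]; rewrite !inE wU orbT.
    exists q => //; subst w; move: wU; rewrite /phi !inE => /andP[_ ->].
    by rewrite qT !inE eqxx.
  have [pU|pU] := boolP (p \in U); last first.
    rewrite /phi (negPf pU) => A ZA ZnA.
    have [a [b [aZ bZ /and4P[_ _ _]]]] := cU A ZA ZnA.
    have ap : a != p by apply: contraNneq pU => <-; move: aZ; rewrite !inE -andbA => /and3P[].
    have bp : b != p by apply: contraNneq pU => <-; move: bZ; rewrite !inE => /and3P[].
    by rewrite (negPf ap) (negPf bp) !orbF => ab; exists a, b.
  have -> : phi U :\: T = q |: (U :\: T).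
    rewrite /phi pU; apply/setP=> x; rewrite !inE.
    by have [->|] := eqVneq x q; rewrite ?qT.
  move=> A ZA ZnA.
  (* If [A] separates [p] from [q], the edge [pq] crosses. Otherwise a crossing edge of the
     contracted graph lifts, with [q] in place of [p] where necessary. *)
  have [qpA|] := eqVneq (q \in A) (p \in A); last first.
    move=> qpA; have [pA|pA] := boolP (p \in A).
      exists p, q; rewrite !inE eqxx pA pT pU orbT epq; split=> //.
      by move: qpA; rewrite pA; case: (q \in A).
    exists q, p; rewrite !inE eqxx (negPf pA) pT pU orbT se epq; split=> //.
    by move: qpA; rewrite (negPf pA); case: (q \in A).
  have inZ x : x \in U :\: T -> x \in q |: (U :\: T) by move=> xW; rewrite inE xW orbT.
  have qZ : q \in q |: (U :\: T) by rewrite !inE eqxx.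
  have pW : p \in U :\: T by rewrite inE pT.
  have [||a [b [/setIP[aZ aA] /setDP[bZ bA] /and4P[_ _ _]]]] := cU A.
  - case/set0Pn: ZA => x /setIP[/setU1P[->|xW] xA]; apply/set0Pn.
      by exists p; rewrite inE pW -qpA.
    by exists x; rewrite inE xW.
  - case/set0Pn: ZnA => x /setDP[/setU1P[->|xW] xA]; apply/set0Pn.
      by exists p; rewrite inE pW -qpA xA.
    by exists x; rewrite inE xW xA.
  case/or3P=> [ab|/andP[/eqP ap qb]|/andP[/eqP bp aq]].
  + by exists a, b; split; rewrite // inE ?aA ?bA inZ.
  + by subst a; exists q, b; split; rewrite // inE ?qpA ?aA ?bA ?qZ ?inZ.
  + by subst b; exists a, q; split; rewrite // inE ?qpA ?aA ?bA ?qZ ?inZ.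
- move=> _ _ /imsetP[U UH ->] /imsetP[U' UH' ->] UU'.
  have {}UU' : U != U' by apply: contraNneq UU' => ->.
  have sub := dH U U' UH UH' UU'.
  have np : p \in U -> p \in U' -> False.
    by move=> pU pU'; have := subsetP sub p; rewrite inE pU pU' (negPf pT) => /(_ isT).
  have := qH U UH; have := qH U' UH' => qU' qU.
  apply/subsetP=> x /setIP[]; rewrite /phi.
  have [pU|_] := boolP (p \in U); have [pU'|_] := boolP (p \in U').
  + by case: np.
  + move=> /setU1P[->|xU] xU'; first by rewrite xU' in qU'.
    by apply: (subsetP sub); rewrite inE xU.
  + move=> xU /setU1P[xq|xU']; first by rewrite -xq xU in qU.
    by apply: (subsetP sub); rewrite inE xU.
  + by move=> xU xU'; apply: (subsetP sub); rewrite inE xU.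
move=> A TA TnA; apply: leq_trans (cH A TA TnA) _.
have sub : hcut terminals_of H T A \subset H by apply/subsetP=> U; rewrite inE => /andP[].
rewrite -(card_in_imset (sub_in2 (subsetP sub) phi_inj)).
apply: subset_leq_card; apply/subsetP=> _ /imsetP[U UC ->].
move: UC; rewrite !inE /crosses /terminals_of phiT => /andP[UH ->].
by rewrite imset_f.
Qed.

Lemma exists_hyperedge_system e :
  symmetric e -> irreflexive e -> cut_connected T k e ->
  exists H, hyperedge_system e H.
Proof.
pose nt (e : rel V) := [set p : V * V | [&& p.1 \notin T, p.2 \notin T & e p.1 p.2]].
pose nv (e : rel V) := [set x | [exists y, e x y]].
(* A lexicographic measure: contraction isolates [q] and so lowers [nv], possibly raising [nt],
   which stays below the weight; deletion lowers [nt] and does not raise [nv]. *)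
pose mu e := #|nv e| * #|{: V * V}|.+1 + #|nt e|.
have [n] := ubnP (mu e); elim: n e => // n IH e; rewrite ltnS => mun se ie ce.
have [nt0|] := eqVneq (nt e) set0.
  apply: hyperedge_system_bipartite => // p q epq; apply: contraTT epq.
  rewrite negb_or => /andP[pT qT]; apply/negP=> epq.
  by move/setP/(_ (p, q)): nt0; rewrite !inE /= pT qT epq.
case/set0Pn=> -[p q]; rewrite inE /= => /and3P[pT qT epq].
have [cd|cc] := delete_or_contract se ie epq pT qT ce.
  have [||||H HP] := IH (delete_edge e p q).
  - apply: leq_trans mun; rewrite /mu -addnS; apply: leq_add.
      rewrite leq_pmul2r //; apply: subset_leq_card; apply/subsetP=> x.
      rewrite !inE => /existsP[y /andP[xy _]]; by apply/existsP; exists y.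
    apply: proper_card; apply/properP; split.
      by apply/subsetP=> -[x y]; rewrite !inE /= => /and4P[-> -> ->].
    by exists (p, q); rewrite !inE /= ?pT ?qT ?epq // /delete_edge !eqxx andbF.
  - exact: delete_edge_sym.
  - by move=> x; rewrite /delete_edge ie.
  - by [].
  exists H; apply: hyperedge_system_mono HP => x y; by case/andP.
have [||||H HP] := IH (contract_edge e p q).
- apply: leq_trans mun; rewrite /mu.
  apply: (@leq_trans (#|nv e| * #|{: V * V}|.+1)); last exact: leq_addr.
  have lt : #|nv (contract_edge e p q)| < #|nv e|.
    apply: proper_card; apply/properP; split.
      apply/subsetP=> x; rewrite !inE => /existsP[y /and4P[_ _ _]].
      case/or3P=> [xy|/andP[/eqP -> _]|/andP[_ xq]]; apply/existsP;
        [by exists y | by exists q | by exists q].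
    exists q; rewrite !inE; first by apply/existsP; exists p; rewrite se.
    by apply/existsP=> -[y /and4P[_]]; rewrite eqxx.
  apply: leq_trans (_ : #|nv (contract_edge e p q)|.+1 * #|{: V * V}|.+1 <= _); last first.
    by rewrite leq_pmul2r.
  by rewrite mulSn addnC -addSn leq_add2r ltnS max_card.
- exact: contract_edge_sym.
- by move=> x; rewrite /contract_edge eqxx.
- by [].
exact: hyperedge_system_contract HP.
Qed.

End Reduction.

(** * From disjoint paths to the cut condition *)

Lemma path_crosses_cut (G : sgraph) (A B : {set G}) u p :
  [disjoint A & B] -> path (@sedge G) u p -> u \in A -> last u p \in B ->
  (exists x, [/\ x \notin A, x \notin B & x \in u :: p]) \/
  (exists a b, [/\ a \in A, b \in B, sedge a b & [set a; b] \in path_edges u p]).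
Proof.
move=> dAB; elim: p u => [|y p IH] u /=.
  by move=> _ uA uB; move/pred0P/(_ u): dAB; rewrite /= uA uB.
case/andP=> uy yp uA lB.
have [yB|yB] := boolP (y \in B).
  by right; exists u, y; rewrite uA yB uy /path_edges /= inE eqxx.
have [yA|yA] := boolP (y \in A); last first.
  by left; exists y; rewrite yA yB !inE eqxx orbT.
have [[x [xA xB xp]]|[a [b [aA bB ab abp]]]] := IH y yp yA lB.
  by left; exists x; rewrite xA xB inE xp orbT.
by right; exists a, b; rewrite aA bB ab /path_edges /= inE abp orbT.
Qed.

(** The easy half of Menger's theorem: each path picks a removed vertex or a cut edge on it. Removed
    vertices are non-terminals, so disjointness makes the choice injective. *)
Lemma disjoint_paths_cut (G : sgraph) (T A B : {set G}) u v k :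
  separates T A B -> u \in A -> v \in B -> disjoint_paths T u v k ->
  k <= cutval (@sedge G) A B.
Proof.
move=> [dAB tAB _ _] uA vB [p [pP dp]].
pose X := [set x | (x \notin A) && (x \notin B)].
pose E := [set w : G * G | [&& w.1 \in A, w.2 \in B & sedge w.1 w.2]].
pose P i (w : G + G * G) := match w with
  | inl x => x \in X /\ x \in u :: p i
  | inr w => w \in E /\ [set w.1; w.2] \in path_edges u (p i) end.
have /choice[g gP] : forall i, exists w, P i w.
  move=> i; have /and3P[pp /eqP lp _] := pP i.
  have [|[x [xA xB xp]]|[a [b [aA bB ab abp]]]] := path_crosses_cut dAB pp uA.
  - by rewrite lp.
  - by exists (inl x); rewrite /= inE xA xB.
  - by exists (inr (a, b)); rewrite /= inE /= aA bB ab.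
have ginj : injective g.
  move=> i j gij; apply/eqP; apply: contraT => /dp[de dv].
  have := gP i; have := gP j; rewrite -gij; case: (g i) => [x|w] /= [xX xj] [_ xi].
    have xT : x \notin T.
      apply: contraTN xX => /(subsetP tAB); rewrite !inE.
      by case: (x \in A) => //= ->.
    by have := dv x xT xi; rewrite xj.
  by have := de _ xi; rewrite xj.
rewrite /cutval !sum_nat_of_bool -/X -/E -[k]card_ord -(card_codom ginj).
apply: (@leq_trans #|[set inl x | x in X] :|: [set inr w | w in E]|).
  apply: subset_leq_card; apply/subsetP=> _ /codomP[i ->].
  have := gP i; case: (g i) => [x|w] /= [xX _]; rewrite inE.
    by rewrite imset_f.
  by rewrite orbC imset_f.
apply: leq_trans (leq_card_setU _ _) _.
by apply: leq_add; apply: leq_imset_card.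
Qed.

Lemma element_connectivity_cut_connected (G : sgraph) (T : {set G}) k :
  1 < #|T| -> k <= set_element_connectivity T -> cut_connected T k (@sedge G).
Proof.
move=> T1 /(set_element_connectivity_geP k T1) kT A B sAB; case: (sAB).
move=> dAB _ /set0Pn[u /setIP[uT uA]] /set0Pn[v /setIP[vT vB]].
have uv : u != v.
  by apply: contraTneq uA => ->; apply/negP=> vA; move/pred0P/(_ v): dAB; rewrite /= vA vB.
apply: (disjoint_paths_cut sAB uA vB).
exact/(element_connectivity_geP T k uv)/kT.
Qed.

(** * Connectivity in the graph from connectivity by hyperedges *)

Section Packing.
Variables (G : sgraph) (T : {set G}).
Implicit Types (U P : {set G}) (F H : {set {set G}}).

(** If [A] splits one of the hyperedges, that hyperedge supplies the edge. Otherwise every vertex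
    lies on the same side as some terminal of [P], so [A] splits [P] with no hyperedge crossing, a
    contradiction. *)
Lemma hyperedge_union_connected F P (e : rel G) :
  (forall U, U \in F -> U :&: T != set0) ->
  (forall U, U \in F -> U :&: T \subset P -> connected_in e U) ->
  hconnected (terminals_of T) F P ->
  connected_in e (P :|: \bigcup_(U in F | U :&: T \subset P) U).
Proof.
move=> nF cF cP A /set0Pn[a /setIP[aZ aA]] /set0Pn[b /setDP[bZ bA]].
set Z := P :|: _ in aZ bZ *.
have [[U [UF UP UA UnA]]|nsplit] := pselect (exists U, [/\ U \in F,
    U :&: T \subset P, U :&: A != set0 & U :\: A != set0]).
  have [x [y [/setIP[xU xA] /setDP[yU yA] xy]]] := cF U UF UP A UA UnA.
  have UZ z : z \in U -> z \in Z.
    by move=> zU; rewrite inE; apply/orP; right; apply/bigcupP; exists U; rewrite ?UF.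
  exists x, y; split=> //; first by apply/setIP; rewrite UZ.
  by apply/setDP; rewrite UZ.
have same z : z \in Z -> exists2 t, t \in P & (t \in A) = (z \in A).
  case/setUP=> [zP|/bigcupP[U /andP[UF UP] zU]]; first by exists z.
  have /set0Pn[t /setIP[tU tT]] := nF U UF.
  exists t; first by rewrite (subsetP UP) // inE tU.
  apply/idP/idP=> xA; apply: contraT => yA; case: nsplit; exists U; split=> //;
    apply/set0Pn.
  - by exists t; rewrite inE tU.
  - by exists z; rewrite inE zU yA.
  - by exists z; rewrite inE zU.
  - by exists t; rewrite inE tU yA.
have [t tP tA] := same a aZ; have [s sP sA] := same b bZ.
have [||U /and3P[UF UP /andP[U1 U2]]] := cP A.
- by apply/set0Pn; exists t; rewrite inE tP tA.
- by apply/set0Pn; exists s; rewrite inE sP sA bA.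
case: nsplit; exists U; split=> //.
  by apply: contraNneq U1 => E; rewrite /terminals_of setIAC E set0I.
by apply: contraNneq U2 => E; rewrite /terminals_of -setIDAC E set0I.
Qed.

Definition hyperedge_edge U : rel G :=
  fun x y => [&& sedge x y, [set x; y] \subset U &
    ~~ ([set x; y] \subset T) || ([set x; y] == U)].

(** If the cut does not split the non-terminals of [U], they all lie on one side, and a vertex on
    the other side is a terminal attached to one of them. *)
Lemma hyperedge_connected U :
  is_hyperedge T (@sedge G) U -> connected_in (hyperedge_edge U) U.
Proof.
move=> [nU hU] A UA UnA; case: hU => [[x [y [UE xT yT xy]]]|[cW aW]].
  case/set0Pn: UA => a /setIP[aU aA]; case/set0Pn: UnA => b /setDP[bU bA].
  have ab : a != b by apply: contraNneq bA => <-.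
  have UE' : U = [set a; b].
    move: aU bU ab; rewrite UE !inE => /orP[] /eqP -> /orP[] /eqP ->;
      by rewrite ?eqxx // setUC.
  exists a, b; rewrite !inE aU aA bU bA /hyperedge_edge -UE' subxx eqxx orbT; split=> //.
  rewrite !andbT; move: aU bU ab; rewrite UE !inE => /orP[] /eqP -> /orP[] /eqP ->;
    by rewrite ?eqxx // sedge_sym.
have he a b : a \in U -> b \in U -> (a \notin T) || (b \notin T) -> sedge a b ->
    hyperedge_edge U a b.
  move=> aU bU abT ab; rewrite /hyperedge_edge ab !subUset !sub1set aU bU /=.
  by rewrite negb_and abT.
have [/andP[W1 W2]|nW] :=
    boolP (((U :\: T) :&: A != set0) && ((U :\: T) :\: A != set0)).
  have [a [b [/setIP[/setDP[aU aT] aA] /setDP[/setDP[bU bT] bA] ab]]] := cW A W1 W2.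
  by exists a, b; rewrite !inE aU bU aA bA; split=> //; apply: he; rewrite ?aT.
have same w z : w \in U :\: T -> z \in U :\: T -> w \in A -> z \in A.
  move=> wW zW wA; apply: contraNT nW => zA; apply/andP; split; apply/set0Pn.
    by exists w; rewrite inE wW.
  by exists z; rewrite inE zA.
have rep z : z \in U -> exists w, [/\ w \in U :\: T,
    (w == z) || sedge w z & (w == z) || (z \in T)].
  move=> zU; have [zT|zT] := boolP (z \in T); last by exists z; rewrite inE zU zT eqxx.
  have [|w wW wz] := aW z; first by rewrite inE zU.
  by exists w; rewrite wW wz !orbT.
case/set0Pn: UA => a /setIP[aU aA]; case/set0Pn: UnA => b /setDP[bU bA].
have [w [wW wa aT]] := rep a aU; have [z [zW zb bT]] := rep b bU.
have /setDP[wU wT] := wW; have /setDP[zU zT] := zW.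
have [wA|wA] := boolP (w \in A).
  have zA := same w z wW zW wA.
  exists z, b; rewrite !inE zA zU bA bU; split=> //; apply: he; rewrite ?zT //.
  by case/orP: zb => // /eqP zb; rewrite -zb zA in bA.
exists a, w; rewrite !inE aU aA wA wU; split=> //; apply: he; rewrite ?wT ?orbT //.
case/orP: wa => [/eqP wa|]; first by rewrite wa aA in wA.
by rewrite sedge_sym.
Qed.

End Packing.

(** * Packing Steiner trees *)

Lemma treewidth_decomposition (G : sgraph) r :
  0 < r -> treewidth G <= r - 1 ->
  exists (D : sgraph) (B : D -> {set G}),
    tree_decomposition B /\ forall i, #|B i| <= r.
Proof.
move=> r0; rewrite /treewidth; case: ex_minnP => w /asboolP[D [B [tdB wB]]] _ wr.
exists D, B; split=> // i.
have le : #|B i| <= \max_(j : D) #|B j| by apply: leq_bigmax.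
apply: leq_trans le _; move: wB; rewrite /width => wB.
by rewrite -(prednK r0) -subn1; apply: leq_trans (leqSpred _) _; rewrite ltnS wB.
Qed.

Lemma card_disjoint_family (J V : finType) (S : {set J}) (Z : J -> {set V})
    (B : {set V}) :
  (forall j, j \in S -> Z j :&: B != set0) ->
  (forall j j' x, j \in S -> j' \in S -> x \in Z j -> x \in Z j' -> j = j') ->
  #|S| <= #|B|.
Proof.
move=> ZB dZ; pose h x := [pick j in S | x \in Z j].
rewrite -(card_imset (mem S) Some_inj); apply: leq_trans (leq_imset_card h _).
apply: subset_leq_card; apply/subsetP=> _ /imsetP[j jS ->].
have /set0Pn[x /setIP[xZ xB]] := ZB j jS.
apply/imsetP; exists x => //; rewrite /h.
case: pickP => [j' /andP[j'S xZ']|/(_ j)]; last by rewrite jS xZ.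
by rewrite (dZ j j' x).
Qed.

(** * Merging parts and colouring the hyperedges *)

Section Colouring.
Variables (G : sgraph) (T : {set G}) (k r m : nat) (H : {set {set G}}).
Hypotheses (r_gt0 : 0 < r) (tw_r : treewidth G <= r - 1).
Hypothesis sysH : hyperedge_system T k (@sedge G) H.
Implicit Types (f : G -> G).

Let inc := terminals_of T.
(** A partition of the terminals is encoded by a labelling [f], with vertices of [G] as labels; the
    identity gives singletons. *)
Definition part f l := [set x in T | f x == l].

Let blob f l := part f l :|: \bigcup_(U in H | U :&: T \subset part f l) U.

(** A terminal determines its label. A non-terminal lies in only one hyperedge, and a terminal of
    that hyperedge determines the label. *)
Lemma blob_disjoint f l l' x : x \in blob f l -> x \in blob f l' -> l = l'.
Proof.
case: sysH => hH dH _.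
have inT j : x \in blob f j -> x \in T -> f x = j.
  case/setUP=> [|/bigcupP[U /andP[_ UP] xU] xT]; first by rewrite inE => /andP[_ /eqP].
  by have := subsetP UP x; rewrite !inE xU xT => /(_ isT)/eqP.
have outT j : x \in blob f j -> x \notin T ->
    exists2 U, U \in H & x \in U /\ U :&: T \subset part f j.
  case/setUP=> [|/bigcupP[U /andP[UH UP] xU] xT]; last by exists U.
  by rewrite inE => /andP[->].
move=> xl xl'; have [xT|xT] := boolP (x \in T); first by rewrite -(inT l) ?(inT l').
have [U UH [xU UP]] := outT l xl xT; have [U' UH' [xU' UP']] := outT l' xl' xT.
have [UU'|UU'] := eqVneq U U'.
  subst U'; have [/set0Pn[t tU] _] := hH U UH.
  have := subsetP UP t tU; have := subsetP UP' t tU.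
  by rewrite !inE => /andP[_ /eqP <-] /andP[_ /eqP].
have := subsetP (dH U U' UH UH' UU') x; rewrite inE xU xU' (negPf xT).
by move/(_ isT).
Qed.

(** An edge inside [T] at [Z] ends in [D]. Otherwise the connected non-terminals of [U] enter [D]
    next to [Z] and cannot leave it, as they avoid [B]; the terminals attached to them follow. *)
Lemma hyperedge_behind_separator (U Z B D : {set G}) :
  is_hyperedge T (@sedge G) U -> U :&: T :&: Z != set0 -> (U :\: T) :&: B = set0 ->
  Z \subset D -> (forall z b, z \in Z -> sedge z b -> b \in D) ->
  (forall a b, a \in D -> a \notin B -> sedge a b -> b \in D) ->
  forall u, u \in U :&: T -> u \in D.
Proof.
move=> [nU hU] /set0Pn[z /setIP[zU zZ]] WB ZsubD ZD DD u uU.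
case: hU => [[x [y [UE _ _ xy]]]|[cW aW]].
  have [uz|uz] := eqVneq u z; first by rewrite uz (subsetP ZsubD).
  apply: ZD zZ _; move: zU uU uz; rewrite UE !inE.
  case/andP=> /orP[] /eqP -> _ /andP[/orP[] /eqP -> _]; rewrite ?eqxx //.
  by rewrite sedge_sym.
have WnB w : w \in U :\: T -> w \notin B.
  by move=> wW; apply/negP=> wB; move/setP/(_ w): WB; rewrite inE wW wB inE.
have [w wW wz] := aW z zU; have wD : w \in D by apply: ZD zZ _; rewrite sedge_sym.
have WD : (U :\: T) :\: D = set0.
  apply/eqP; apply: contraT => nD.
  have [|a [b [/setIP[aW' aD] /setDP[_ bD] ab]]] := cW D _ nD.
    by apply/set0Pn; exists w; rewrite inE wW.
  by rewrite (DD a b aD (WnB a aW') ab) in bD.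
have [v vW vu] := aW u uU; apply: DD vu; last exact: WnB.
by move/setP/(_ v): WD; rewrite inE vW andbT inE => /negbFE.
Qed.

(** The separator is applied to the blobs. [S] holds the labels of blobs meeting the bag, at most
    [r] by disjointness. [H0] holds the hyperedges leaving the lowest part without a non-terminal in
    the bag; again at most [r] are lost. Their terminals lie behind the bag, so the blobs of these
    terminals meet the bag. *)
Lemma exists_dense_labels f :
  1 < #|f @: T| ->
  (forall l, l \in f @: T -> hconnected inc H (part f l)) ->
  exists S H0 : {set _}, [/\ S \subset f @: T, #|S| <= r, H0 \subset H,
    k <= #|H0| + r &
    forall U, U \in H0 -> 1 < #|f @: inc U| /\ f @: inc U \subset S].
Proof.
move=> fT1 cP; case: (sysH) => hH dH kH.
have [D [B [tdB Br]]] := treewidth_decomposition r_gt0 tw_r.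
have cZ l : l \in f @: T -> connected_in (@sedge G) (blob f l).
  move=> /cP cl; apply: hyperedge_union_connected cl => U UH; first by case: (hH U UH).
  by move=> _; apply: connected_in_mono (hyperedge_connected (hH U UH)) => x y /and3P[].
have [|l0 [x [X [l0T l0X ZX XX meet]]]] := tree_decomposition_separator tdB _ cZ.
  by rewrite -card_gt0 ltnW.
pose P0 := part f l0.
pose C := hcut inc H T P0.
pose C1 := [set U in C | (U :\: T) :&: B x != set0].
pose S := [set l in f @: T | blob f l :&: B x != set0].
have kC : k <= #|C|.
  apply: kH.
    case/imsetP: l0T => t tT l0t; apply/set0Pn; exists t.
    by rewrite !inE tT l0t eqxx.
  have [l1 l1T l10] : exists2 l1, l1 \in f @: T & l1 != l0.
    apply/exists_inP; apply: contraTT fT1; rewrite negb_exists_in -leqNgt => /forall_inP no.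
    rewrite -(cards1 l0); apply: subset_leq_card; apply/subsetP=> l lT; rewrite inE.
    by have := no l lT; rewrite negbK.
  case/imsetP: l1T l10 => t tT ->; move=> tl0; apply/set0Pn; exists t.
  by rewrite !inE tT (negPf tl0).
have C1r : #|C1| <= r.
  apply: leq_trans (Br x); apply: (card_disjoint_family (Z := fun U => U :\: T)).
    by move=> U; rewrite inE => /andP[].
  move=> U U' z; rewrite !inE => /andP[/andP[UH _] _] /andP[/andP[UH' _] _].
  move=> /andP[zT zU] /andP[_ zU']; apply/eqP; apply: contraT => /(dH U U' UH UH')/subsetP/(_ z).
  by rewrite inE zU zU' (negPf zT) => /(_ isT).
exists S, (C :\: C1); split.
- by apply/subsetP=> l; rewrite inE => /andP[].
- apply: leq_trans (Br x); apply: (card_disjoint_family (Z := blob f)).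
    by move=> l; rewrite inE => /andP[].
  by move=> l l' z _ _; exact: blob_disjoint.
- by apply/subsetP=> U; rewrite !inE => /andP[_ /andP[]].
- apply: leq_trans kC _; rewrite -(cardsID C1 C) addnC leq_add2l.
  by apply: leq_trans C1r; apply: subset_leq_card; apply: subsetIr.
move=> U /setDP[UC UC1].
have WB : (U :\: T) :&: B x = set0 by apply/eqP; move: UC1; rewrite inE UC negbK.
move: UC; rewrite inE => /and3P[UH _ /andP[U1 U2]].
split.
  case/set0Pn: U1 => a /setIP[aU]; rewrite inE => /andP[_ /eqP al].
  case/set0Pn: U2 => b /setDP[bU]; rewrite inE.
  have -> : b \in T by case/setIP: bU.
  move=> /= bl; apply/card_gt1P; exists (f a), (f b); rewrite !imset_f //.
  by split=> //; rewrite al eq_sym.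
apply/subsetP=> _ /imsetP[u uU ->].
have uT : u \in T by case/setIP: uU.
have ub : u \in blob f (f u) by rewrite !inE uT eqxx.
rewrite inE imset_f //=.
have U1' : U :&: T :&: blob f l0 != set0.
  case/set0Pn: U1 => a /setIP[aU aP]; apply/set0Pn; exists a.
  by rewrite inE aU inE aP.
have uX := hyperedge_behind_separator (hH U UH) U1' WB l0X ZX XX uU.
by apply: meet; rewrite ?imset_f //; apply/set0Pn; exists u; rewrite inE ub.
Qed.

(** Induction on the number of parts, with the invariant that each of the [m] colours connects every
    part; it starts from singletons and ends with one part. *)
Lemma colour_terminals :
  0 < m -> T != set0 -> m * r ^ 2 + r <= k ->
  exists col : {set G} -> nat,
    forall c, c < m -> hconnected inc [set U in H | col U == c] T.
Proof.
move=> m0 Tn mk.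
suff grow n f (col : {set G} -> nat) : #|f @: T| <= n ->
    (forall c l, c < m -> l \in f @: T ->
       hconnected inc [set U in H | col U == c] (part f l)) ->
    exists col : {set G} -> nat,
      forall c, c < m -> hconnected inc [set U in H | col U == c] T.
  apply: (grow _ id (fun=> 0) (leqnn _)) => c l _ _ A /set0Pn[a] + /set0Pn[b].
  rewrite !inE => /andP[/andP[_ /eqP ->] lA] /andP[bA /andP[_ /eqP bl]].
  by rewrite bl lA in bA.
elim: n f col => [|n IH] f col fn cP.
  case/set0Pn: Tn => t tT; move: fn; rewrite leqn0 cards_eq0 => /eqP/setP/(_ (f t)).
  by rewrite imset_f // inE.
have [fT1|fT1] := leqP #|f @: T| 1.
  exists col => c cm; case/set0Pn: Tn => t tT.
  have <- : part f (f t) = T; last by apply: cP; rewrite ?imset_f.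
  apply/setP=> x; rewrite inE; case xT: (x \in T) => //=.
  by apply/eqP/(card_le1_eqP fT1); rewrite imset_f.
have cH l : l \in f @: T -> hconnected inc H (part f l).
  move=> lT; apply: hconnected_mono (cP 0 l m0 lT) => U.
  by rewrite inE => /andP[].
have [S [H0 [ST Sr H0H kH0 H0P]]] := exists_dense_labels fT1 cH.
have mrH0 : m * r ^ 2 <= #|H0| by rewrite -(leq_add2r r); apply: leq_trans mk kH0.
have H0n : H0 != set0.
  by rewrite -card_gt0; apply: leq_trans mrH0; rewrite muln_gt0 m0 expn_gt0 r_gt0.
(* The hypergraph now lives on the labels. Density [m * r] is available because [S] has at most [r]
   labels, and it makes every cut of [S'] at least [m * #|S'|]. *)
have [|S' S'S [S'1 cutS']] := dense_subset (q := fun U => f @: inc U) (mu := m * r) H0P H0n.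
  apply: leq_trans mrH0; rewrite -mulnn mulnA leq_mul2l.
  by rewrite (leq_trans (leq_pred _) Sr) orbT.
have S'n : S' != set0 by rewrite -card_gt0 ltnW.
have [|col0 col0P] := connected_colouring (q := fun U => f @: inc U) (m := m) (H := H0) S'n.
  move=> A SA SnA; apply: leq_trans (cutS' A SA SnA).
  by rewrite leq_mul2l (leq_trans (subset_leq_card S'S) Sr) orbT.
have S'T : S' \subset f @: T := subset_trans S'S ST.
case/card_gt1P: S'1 => s0 [s1 [s0S s1S s01]].
pose f' x := if f x \in S' then s0 else f x.
pose col' U := if U \in H0 then col0 U else col U.
(* Recolouring [H0] spoils no earlier connection, since a hyperedge of [H0] has terminals with
   different labels and so lies in no old part. *)
have old c l : c < m -> l \in f @: T ->
    hconnected inc [set U in H | col' U == c] (part f l).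
  move=> cm lT; apply: hconnected_mono (cP c l cm lT) => U.
  rewrite !inE => /andP[UH Uc] UP; rewrite UH /col'; case: ifP => // UH0.
  have [+ _] := H0P U UH0; rewrite ltnNge => /negP[].
  rewrite -(cards1 l); apply: subset_leq_card; apply/subsetP=> _ /imsetP[u uU ->].
  by have := subsetP UP u uU; rewrite !inE => /andP[].
apply: (IH f' col').
  rewrite -ltnS; apply: leq_trans fn; apply: proper_card; apply/properP; split.
    apply/subsetP=> _ /imsetP[x xT ->]; rewrite /f'; case: ifP => _.
      exact: subsetP S'T s0 s0S.
    by rewrite imset_f.
  exists s1; first exact: subsetP S'T s1 s1S.
  apply/imsetP=> -[x _]; rewrite /f'; case: ifP => [_ /eqP|xS E].
    by rewrite eq_sym (negPf s01).
  by rewrite -E s1S in xS.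
move=> c l cm lT.
have [lS|lS] := boolP (l \in S'); last first.
  have E : part f' l = part f l.
    apply/setP=> x; rewrite !inE /f'; case: ifP => // xS; congr (_ && _).
    have -> : (s0 == l) = false by apply: contraNF lS => /eqP <-.
    by apply/esym/negbTE; apply: contraNneq lS => <-.
  rewrite E; apply: old => //; case/imsetP: lT lS => x xT ->; rewrite /f'.
  by case: ifP => [_|_ _]; [rewrite s0S | rewrite imset_f].
have ls0 : l = s0.
  case/imsetP: lT lS => x xT ->; rewrite /f'; case: ifP => // xS.
  by rewrite xS.
subst l => A PA PnA.
have inP x : (x \in part f' s0) = (x \in T) && (f x \in S').
  rewrite !inE /f'; case: ifP => xS; first by rewrite eqxx.
  by congr (_ && _); apply: contraFF xS => /eqP ->.
(* If [A] splits an old part, its old connection crosses. Otherwise [A] restricts to a union of old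
   parts, that is, to the set [A'] of labels, and the new colouring of [S'] applies. *)
have [[l [lS' lA lnA]]|nsplit] := pselect (exists l, [/\ l \in S',
    part f l :&: A != set0 & part f l :\: A != set0]).
  have [U /and3P[Uc UP UA]] := old c l cm (subsetP S'T l lS') A lA lnA.
  exists U; rewrite Uc UA andbT /=; apply: subset_trans UP _.
  by apply/subsetP=> x; rewrite inP inE => /andP[-> /eqP ->].
have same x y : x \in T -> y \in T -> f x \in S' -> f y = f x ->
    x \in A -> y \in A.
  move=> xT yT xS yx xA; apply: contraT => yA; case: nsplit.
  exists (f x); split=> //; apply/set0Pn.
    by exists x; rewrite !inE xT eqxx.
  by exists y; rewrite !inE yT yx eqxx yA.
pose A' := f @: (part f' s0 :&: A).
have A'P x : x \in T -> f x \in S' -> (f x \in A') = (x \in A).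
  move=> xT xS; apply/imsetP/idP=> [[y /setIP[yP yA] xy]|xA].
    by move: yP; rewrite inP => /andP[yT yS]; apply: (same y x).
  by exists x; rewrite // inE inP xT xS.
have [||U /and3P[Uc US /andP[U1 U2]]] := col0P c cm A'.
- case/set0Pn: PA => x /setIP[xP xA]; apply/set0Pn; exists (f x).
  by move: xP; rewrite inP inE => /andP[xT xS]; rewrite A'P ?xA ?xS.
- case/set0Pn: PnA => x /setDP[xP xA]; apply/set0Pn; exists (f x).
  by move: xP; rewrite inP inE => /andP[xT xS]; rewrite A'P ?xA ?xS.
have incT u : u \in inc U -> (u \in T) /\ (f u \in S').
  by move=> uU; split; [case/setIP: uU | apply: (subsetP US); rewrite imset_f].
move: Uc; rewrite inE => /andP[UH0 Uc].
exists U; apply/and3P; split.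
- by rewrite inE (subsetP H0H) //= /col' UH0.
- by apply/subsetP=> u /incT[uT uS]; rewrite inP uT.
- apply/andP; split.
    case/set0Pn: U1 => _ /setIP[/imsetP[u uU ->] uA]; apply/set0Pn; exists u.
    by have [uT uS] := incT u uU; rewrite inE uU -A'P.
  case/set0Pn: U2 => _ /setDP[/imsetP[u uU ->] uA]; apply/set0Pn; exists u.
  by have [uT uS] := incT u uU; rewrite inE uU andbT -A'P.
Qed.

End Colouring.

(** * Spanning trees by minimality *)

Section SpanningTree.
Variable V : finType.
Implicit Types (E : {set {set V}}) (A : {set V}).

Definition edge_rel E : rel V := [rel x y | [set x; y] \in E].

Lemma edge_rel_connect_sym E : connect_sym (edge_rel E).
Proof. by apply: sym_connect_sym => x y; rewrite /edge_rel /= setUC. Qed.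

(** The rest of the cycle leads from [y] back to [x]. Its first edge ends in [z], which differs from
    [x], and later edges avoid [y], so none of them is the removed edge. *)
Lemma connect_remove_cycle_edge E x y z p :
  ucycle (edge_rel E) [:: x, y, z & p] ->
  subrel (connect (edge_rel E)) (connect (edge_rel (E :\ [set x; y]))).
Proof.
case/andP; rewrite /cycle rcons_cons [path _ _ _]/= => /and3P[_ yz zp].
rewrite /= !inE !negb_or => /and4P[/and3P[xy xz xp] /andP[yz' yp] _ _].
set E' := E :\ _; have yx : connect (edge_rel E') y x.
  have e1 : edge_rel E' y z.
    move: yz; rewrite /edge_rel /= !inE => ->; rewrite andbT; apply/eqP=> /setP/(_ x).
    by rewrite !inE eqxx (negPf xy) (negPf xz).
  apply: connect_trans (connect1 e1) _; apply/connectP; exists (rcons p x).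
    apply: (@sub_in_path _ (predC1 y) (edge_rel E)) zp.
      move=> a b; rewrite !inE /edge_rel /= => ay yb ab; rewrite !inE ab andbT.
      by apply/eqP=> /setP/(_ y); rewrite !inE eqxx orbT ![y == _]eq_sym (negPf ay) (negPf yb).
    rewrite /= eq_sym yz' all_rcons /= xy /=; apply/allP=> b bp /=.
    by apply: contraNneq yp => <-.
  by rewrite last_rcons.
apply: connect_sub => a b ab.
have [abE|abE] := eqVneq [set a; b] [set x; y]; last first.
  by apply: connect1; rewrite /edge_rel /= !inE abE.
have : a \in [set x; y] by rewrite -abE !inE eqxx.
have : b \in [set x; y] by rewrite -abE !inE eqxx orbT.
rewrite !inE => /orP[] /eqP -> /orP[] /eqP ->; rewrite ?connect0 //.
by rewrite edge_rel_connect_sym.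
Qed.

(** An inclusion-minimal edge set that keeps [A] connected has no cycle, since any cycle edge could
    be dropped. *)
Lemma exists_spanning_tree E A :
  A != set0 -> {in A &, forall x y, connect (edge_rel E) x y} ->
  exists2 E' : {set {set V}}, E' \subset E & is_tree A (edge_rel E').
Proof.
move=> An cA.
pose P E := [forall x in A, forall y in A, connect (edge_rel E) x y].
have PE : P E by apply/forall_inP=> x xA; apply/forall_inP=> y yA; exact: cA.
have [E' /minsetP[PE' minE'] E'E] := minset_exists PE.
have cE' : {in A &, forall x y, connect (edge_rel E') x y}.
  by move=> x y xA yA; move/forall_inP/(_ x xA)/forall_inP/(_ y yA): PE'.
exists E' => //; split=> // -[|x [|y [|z p]]] // _ cyc.
have sub := connect_remove_cycle_edge cyc.
have P' : P (E' :\ [set x; y]).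
  by apply/forall_inP=> a aA; apply/forall_inP=> b bA; apply: sub; exact: cE'.
have := minE' _ P' (subsetDl _ _) => Eq.
have : edge_rel E' x y by case/andP: cyc => /andP[].
by rewrite /edge_rel /= -Eq !inE eqxx.
Qed.

Lemma connected_in_connect (e : rel V) A :
  connected_in e A -> {in A &, forall x y, connect e x y}.
Proof.
move=> cA x y xA yA; apply: contraT => nxy.
have [||a [b [/setIP[_ +] /setDP[_ +] ab]]] := cA [set z | connect e x z].
- by apply/set0Pn; exists x; rewrite !inE xA connect0.
- by apply/set0Pn; exists y; rewrite !inE yA nxy.
rewrite !inE => xa /negP[]; exact: connect_trans xa (connect1 ab).
Qed.

End SpanningTree.

(** Each tree spans [T] and the hyperedges of one colour. Different hyperedges meet only in
    terminals, so a common edge of two trees would join two terminals and hence equal two different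
    hyperedges. *)
Lemma coloured_steiner_trees (G : sgraph) (T : {set G}) k H
    (col : {set G} -> nat) m :
  T != set0 -> hyperedge_system T k (@sedge G) H ->
  (forall c, c < m -> hconnected (terminals_of T) [set U in H | col U == c] T) ->
  exists S : 'I_m -> subgraph G,
    (forall i, steiner_tree T (S i)) /\
    (forall i j, i != j -> element_disjoint T (S i) (S j)).
Proof.
move=> Tn [hH dH _] colP.
pose F (c : 'I_m) := [set U in H | col U == c].
pose vs c := T :|: \bigcup_(U in F c | U :&: T \subset T) U.
pose es c := [set g in edges G | [exists U in F c,
  (g \subset U) && (~~ (g \subset T) || (g == U))]].
have FH c U : U \in F c -> U \in H by rewrite inE => /andP[].
have sub_vs c U : U \in F c -> U \subset vs c.
  by move=> UF; apply/subsetP=> x xU; rewrite inE; apply/orP; right; apply/bigcupP;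
    exists U; rewrite ?UF ?subsetIr.
have conn c : {in vs c &, forall x y, connect (edge_rel (es c)) x y}.
  apply: connected_in_connect; apply: hyperedge_union_connected (colP c (ltn_ord c)).
    by move=> U /FH/hH[].
  move=> U UF _; apply: connected_in_mono (hyperedge_connected (hH U (FH c U UF))).
  move=> x y /and3P[xy xyU xyT]; rewrite /edge_rel /= !inE; apply/andP; split.
    by apply/imsetP; exists (x, y); rewrite ?inE.
  by apply/existsP; exists U; rewrite UF xyU xyT.
have vsn c : vs c != set0.
  by case/set0Pn: Tn => t tT; apply/set0Pn; exists t; rewrite inE tT.
have /choice[E' E'P] : forall c, exists E' : {set {set G}},
    E' \subset es c /\ is_tree (vs c) (edge_rel E').
  by move=> c; have [E' ? ?] := exists_spanning_tree (vsn c) (@conn c); exists E'.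
have E'edges c : E' c \subset edges G.
  by apply: subset_trans (E'P c).1 _; apply/subsetP=> g; rewrite inE => /andP[].
have E'ends c g : g \in E' c -> g \subset vs c.
  move/(subsetP (E'P c).1); rewrite inE => /andP[_ /exists_inP[U UF /andP[gU _]]].
  exact: subset_trans gU (sub_vs c U UF).
exists (fun c => Subgraph (E'edges c) (@E'ends c)); split=> [c|c d cd].
  by split; [exact: (E'P c).2 | exact: subsetUl].
have diff U U' : U \in F c -> U' \in F d -> U != U'.
  rewrite !inE => /andP[_ /eqP Uc] /andP[_ /eqP Ud]; apply: contraNneq cd => UU'.
  by apply/eqP/val_inj; rewrite /= -Uc -Ud UU'.
split=> /=.
  apply/pred0P=> g /=; apply/negP=> /andP[/(subsetP (E'P c).1) + /(subsetP (E'P d).1)].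
  rewrite !inE => /andP[_ /exists_inP[U UF /andP[gU gT]]].
  move=> /andP[_ /exists_inP[U' UF' /andP[gU' gT']]].
  have UU' := diff U U' UF UF'.
  have gTs : g \subset T.
    apply: subset_trans (dH U U' (FH _ _ UF) (FH _ _ UF') UU').
    by rewrite subsetI gU.
  move: gT gT'; rewrite gTs /= => /eqP gE /eqP gE'.
  by rewrite -gE -gE' eqxx in UU'.
apply/subsetP=> x /setIP[/setUP[//|/bigcupP[U /andP[UF _] xU]]].
case/setUP=> [//|/bigcupP[U' /andP[UF' _] xU']].
apply: (subsetP (dH U U' (FH _ _ UF) (FH _ _ UF') (diff U U' UF UF'))).
by rewrite inE xU.
Qed.

Lemma steiner_packing (G : sgraph) (T : {set G}) (r k : nat) :
  0 < r -> treewidth G <= r - 1 -> 1 < #|T| -> k <= set_element_connectivity T ->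
  exists (m : nat) (S : 'I_m -> subgraph G),
    [/\ k <= 3 * (m * r ^ 2), forall i, steiner_tree T (S i)
      & forall i j, i != j -> element_disjoint T (S i) (S j)].
Proof.
move=> r0 tw T1 kT; have Tn : T != set0 by rewrite -card_gt0 ltnW.
have [H sysH] := exists_hyperedge_system (@sedge_sym G) (@sedge_irr G)
  (element_connectivity_cut_connected T1 kT).
suff [m [col [km colP]]] : exists m (col : {set G} -> nat), k <= 3 * (m * r ^ 2) /\
    forall c, c < m -> hconnected (terminals_of T) [set U in H | col U == c] T.
  have [S [S1 S2]] := coloured_steiner_trees Tn sysH colP.
  by exists m, S.
have [->|k0] := posnP k; first by exists 0, (fun=> 0).
have r2 : 0 < r ^ 2 by rewrite expn_gt0 r0.
have rr : r <= r ^ 2 by rewrite -mulnn leq_pmulr.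
(* If the quotient is 0, then [k < r ^ 2 + r], and one tree suffices: with a single colour every cut
   is crossed, since [k] is positive. *)
have [m0|m0] := posnP ((k - r) %/ r ^ 2).
  exists 1, (fun=> 0); split.
    have : k - r < r ^ 2 by rewrite -[ltnRHS]mul1n -ltn_divLR // m0.
    by clear -rr; rewrite mul1n; move: (r ^ 2) rr => a; lia.
  case=> // _ A TA TnA; case: sysH => _ _ /(_ A TA TnA) kA.
  have /set0Pn[U] : hcut (terminals_of T) H T A != set0.
    by rewrite -card_gt0; apply: leq_trans kA.
  by rewrite inE => /and3P[UH UT UA]; exists U; rewrite inE UH UT UA.
set m := _ %/ _ in m0.
have kr : r <= k by case: (leqP r k) m0 => // /ltnW; rewrite /m -subn_eq0 => /eqP ->; rewrite div0n.
have mk : m * r ^ 2 + r <= k by rewrite addnC -leq_subRL // leq_divM.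
have [col colP] := colour_terminals r0 tw sysH m0 Tn mk.
exists m, col; split=> //.
(* Here [k < r + r ^ 2 + m * r ^ 2], and each of the three terms is at most [m * r ^ 2]; this is the
   factor 3. *)
have : k - r < m.+1 * r ^ 2 by rewrite ltn_ceil.
rewrite mulSn => lt; have : r ^ 2 <= m * r ^ 2 by rewrite leq_pmull.
by clear -lt rr kr; move: (m * r ^ 2) (r ^ 2) lt rr => a b; lia.
Qed.

(** * The bound over the reals *)

Import Order.TTheory GRing.Theory Num.Theory.
Local Open Scope ring_scope.

Theorem theorem7 (R : realType) :
  exists c : R, 0 < c /\
    forall (G : sgraph) (r k : nat) (T : {set G}),
      (0 < r)%N -> (treewidth G <= r - 1)%N ->
      (1 < #|T|)%N -> (k <= set_element_connectivity T)%N ->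
      exists (m : nat) (S : 'I_m -> subgraph G),
        [/\ c * (k%:R / (12 * r%:R ^+ 2 * ln (3 * r%:R))) <= m%:R,
            forall i, steiner_tree T (S i)
          & forall i j, i != j -> element_disjoint T (S i) (S j)].
Proof.
have ln3 : 0 < ln 3 :> R by rewrite ln_gt0 // ltr1n.
(* The packing bound has no logarithm. Since [r] is at least 1, [ln 3] is at most [ln (3 * r%:R)],
   so this constant cancels the logarithm; what remains follows from [k <= 3 * (m * r ^ 2)]. *)
exists (ln 3); split=> // G r k T r0 tw T1 kT.
have [m [S [km S1 S2]]] := steiner_packing r0 tw T1 kT.
exists m, S; split=> //.
have r0R : 0 < r%:R :> R by rewrite ltr0n.
have ln3r : ln 3 <= ln (3 * r%:R) :> R.
  by rewrite ler_ln ?posrE ?mulr_gt0 ?ltr0n // ler_peMr ?ler0n // ler1n.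
have lnr : 0 < ln (3 * r%:R) :> R := lt_le_trans ln3 ln3r.
rewrite mulrA ler_pdivrMr ?mulr_gt0 ?exprn_gt0 ?ltr0n //.
rewrite mulrA [leLHS]mulrC; apply: ler_pM; rewrite ?ler0n ?(ltW ln3) //.
rewrite -natrX -!natrM ler_nat (leq_trans km) // mulnCA leq_mul2l.
by rewrite leq_mul2r orbT orbT.
Qed.
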